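(* There is a polynomial $p$ such that the following holds. For any matrix $L\in\mathbb{R}^{n\times n}$ satisfying $L+L^\intercal\succeq0$ and any cardinality $2\le k\le n$ for which the density $\mu:\binom{[n]}{k}\to\mathbb{R}_{\ge0}$, $\mu(S)=\det(L_{S,S})$, is not identically zero, the $k\leftrightarrow(k-2)$ down-up random walk for $\mu$ has relaxation time at most $p(k)$.
   Context: $L_{S,S}$ is the principal submatrix of $L$ indexed by $S$; when $L+L^\intercal$ is positive semidefinite all principal minors of $L$ are nonnegative. The $k\leftrightarrow\ell$ down-up walk for $\mu$ moves from $S_t$ by choosing $T_t$ uniformly among the $\ell$-subsets of $S_t$ and then choosing $S_{t+1}\supseteq T_t$ with $|S_{t+1}|=k$ with probability proportional to $\mu(S_{t+1})$; it is reversible with respect to $\mu$ with nonnegative real eigenvalues, and its relaxation time is $1/(1-\lambda_2)$ where $\lambda_2$ is the second largest eigenvalue. The statement formalizes the paper's ''relaxation time $\mathrm{poly}(k)$''. *)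

(* Defs.v *)
From HB Require Import structures.
From mathcomp Require Import all_boot all_order all_algebra.
From mathcomp Require Import polyrcf.
From mathcomp Require Import reals constructive_ereal.

Set Implicit Arguments.
Unset Strict Implicit.
Unset Printing Implicit Defensive.

Import Order.TTheory GRing.Theory Num.Theory.
Local Open Scope ring_scope.

(* Symmetry is not part of the definition: it is applied to L + L^T. *)
Definition psd (R : realType) (n : nat) (A : 'M[R]_n) : Prop :=
  forall x : 'cV[R]_n, 0 <= (x^T *m A *m x) 0 0.

(* [enum_val] lists the elements of S in increasing order. *)
Definition principal_submx (R : realType) (n : nat) (L : 'M[R]_n)
    (S : {set 'I_n}) : 'M[R]_#|S| :=
  mxsub (@enum_val _ (mem S)) (@enum_val _ (mem S)) L.

Definition principal_minor (R : realType) (n : nat) (L : 'M[R]_n)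
    (S : {set 'I_n}) : R := \det (principal_submx L S).

Section DownUpWalk.
Variables (R : realType) (T : finType).

(* A density on the k-subsets of T is a function on {set T} of which only the
   values on k-subsets are used. *)
Variables (mu : {set T} -> R) (k l : nat).

Definition density_supp : {set {set T}} :=
  [set S : {set T} | (#|S| == k) && (mu S != 0)].

Definition down_prob (S U : {set T}) : R :=
  if (U \subset S) && (#|U| == l) then 'C(k, l)%:R^-1 else 0.

(* If U is contained in a set of the support and mu >= 0, the denominator is
   positive. *)
Definition up_prob (U S : {set T}) : R :=
  if (U \subset S) && (#|S| == k)
  then mu S / \sum_(S' : {set T} | (U \subset S') && (#|S'| == k)) mu S'
  else 0.

Definition down_up_prob (S S' : {set T}) : R :=
  \sum_(U : {set T}) down_prob S U * up_prob U S'.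

(* The state space is the support of mu: from a k-set outside it, the up step
   may have no admissible target. *)
Definition down_up_mx : 'M[R]_#|density_supp| :=
  \matrix_(i, j) down_up_prob (enum_val i) (enum_val j).

End DownUpWalk.

(* The real eigenvalues in decreasing order, each repeated according to its
   multiplicity as a root of the characteristic polynomial. *)
Definition real_spectrum (R : realType) (m : nat) (P : 'M[R]_m) : seq R :=
  flatten [seq nseq (mup x (char_poly P)) x | x <- rev (rootsR (char_poly P))].

(* With the convention that lambda_2 = 0 for a chain with a single state. *)
Definition lambda2 (R : realType) (m : nat) (P : 'M[R]_m) : R :=
  nth 0 (real_spectrum P) 1.

(* Infinite when lambda_2 = 1, that is, when the chain is reducible; note that
   the field inverse would give 0 there. *)
Definition relaxation_time (R : realType) (m : nat) (P : 'M[R]_m) : \bar R :=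
  if lambda2 P < 1 then ((1 - lambda2 P)^-1)%:E else +oo%E.

(* Main.v *)
(* Assume first that x^T L x > 0 for x <> 0. Then the generating polynomial
   \sum_S z^S mu(S) = det (I + diag z L) has no zero with Re z_i >= 0 for
   all i. Splitting it into even and odd parts and using Gauss-Lucas, its
   homogeneous slices are stable on a sector, and hence, for every U and A,
   the generating polynomial of #|S :&: A| over the k-sets S containing U
   has no root with positive real part. Applied to the link of U, this
   bounds the quadratic form x -> \sum_(a, b) m_ab x_a x_b on centered x in
   two ways: a Schwarz lemma bounds the row sums of the covariance matrix
   by a constant, and the Hurwitz property bounds every cut from below, so
   that Cheeger's inequality gives a uniform local spectral gap. Garland's
   method compares the successive increments of the energies W_j = E_(#|U|
   = j) (\sum_(S >= U) mu f)^2 / (\sum_(S >= U) mu): since the local ratio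
   is 1 - O(1/k') far from the top and bounded near it, every increment is
   at most poly(k) times the one from level k-2 to level k-1, which is a
   Poincare inequality for the k <-> (k-2) walk. The general case follows
   by letting e -> 0 in L + e I. *)
Require Import Defs.
From mathcomp Require Import boolp classical_sets.
From mathcomp Require Import all_boot all_order all_algebra.
From mathcomp Require Import reals constructive_ereal.
From mathcomp Require Import perm polyrcf complex.
From mathcomp Require Import ring lra zify.
Set Implicit Arguments.
Unset Strict Implicit.
Unset Printing Implicit Defensive.
Import Order.TTheory GRing.Theory Num.Theory.
Local Open Scope ring_scope.

Local Notation Re := (@complex.Re _).
Local Notation Im := (@complex.Im _).

(** * Polynomials without roots in a half-plane *)

Section ComplexPoly.
Variable R : rcfType.
Local Notation C := R[i].
Implicit Types (x y z : C) (p : {poly C}).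

(** Two levels must be removed because the k <-> (k-1) walk can be reducible: if [L] is block
    diagonal with skew 2 x 2 blocks, [mu] charges only unions of blocks, and exchanging a single
    element never leaves the current set. Correspondingly the cut bound in a link of rank n carries
    a factor n - 2, so the last increment of the energy is never compared with the others. Neither
    local bound is enough alone. Cheeger gives the ratio lam = 31/32 in every link of rank at least
    3, but costs a factor (1 + lam) / (1 - lam) = 63 per level, exponential in k. The Schwarz bound
    gives lam = 4 / (n - 1), for which the product of these factors telescopes to a polynomial, but
    it says nothing for n <= 5. Hence Cheeger is used for n = 3, 4, 5 only, which is the origin of
    63^3, and the telescoped product has degree 8. The limit e -> 0 is taken in the Poincare
    inequality and not in the eigenvalue, because the state space of the walk is the support of
    [mu], which may shrink at e = 0. *)

Lemma ReD x y : Re (x + y) = Re x + Re y.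
Proof. by case: x y => [a b] [c d]. Qed.

Lemma ReN x : Re (- x) = - Re x.
Proof. by case: x. Qed.

Lemma ReB x y : Re (x - y) = Re x - Re y.
Proof. by rewrite ReD ReN. Qed.

Lemma ReM x y : Re (x * y) = Re x * Re y - Im x * Im y.
Proof. by case: x y => [a b] [c d]. Qed.

Lemma ImM x y : Im (x * y) = Re x * Im y + Im x * Re y.
Proof. by case: x y => [a b] [c d]. Qed.

Lemma ImD x y : Im (x + y) = Im x + Im y.
Proof. by case: x y => [a b] [c d]. Qed.

Lemma ImN x : Im (- x) = - Im x.
Proof. by case: x. Qed.

Lemma Re_sum (I : Type) (r : seq I) (P : pred I) (F : I -> C) :
  Re (\sum_(i <- r | P i) F i) = \sum_(i <- r | P i) Re (F i).
Proof. by elim/big_rec2: _ => // i a b _ <-; rewrite ReD. Qed.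

Lemma Re_inv x : Re x^-1 = Re x / (Re x ^+ 2 + Im x ^+ 2).
Proof. by case: x => a b. Qed.

Lemma Re_neq0 x : 0 < Re x -> x != 0.
Proof. by apply: contraTneq => ->; rewrite ltxx. Qed.

Lemma Re_inv_gt0 x : 0 < Re x -> 0 < Re x^-1.
Proof.
move=> h; rewrite Re_inv divr_gt0 //.
by rewrite ltr_wpDr ?sqr_ge0 // exprn_gt0.
Qed.

(** The squared modulus, valued in [R]: moduli are then compared without square roots. *)
Definition cn2 x : R := Re x ^+ 2 + Im x ^+ 2.

Lemma cn2M x y : cn2 (x * y) = cn2 x * cn2 y.
Proof. by rewrite /cn2 ReM ImM; ring. Qed.

Lemma cn2_ge0 x : 0 <= cn2 x.
Proof. by rewrite addr_ge0 ?sqr_ge0. Qed.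

Lemma cn2_eq0 x : (cn2 x == 0) = (x == 0).
Proof. by rewrite /cn2 paddr_eq0 ?sqr_ge0 // !sqrf_eq0 eq_complex. Qed.

Lemma cn2_gt0 x : (0 < cn2 x) = (x != 0).
Proof. by rewrite lt0r cn2_eq0 cn2_ge0 andbT. Qed.

Lemma cn2N x : cn2 (- x) = cn2 x.
Proof. by rewrite /cn2 ReN ImN !sqrrN. Qed.

Lemma cn2_conj x : cn2 x^*%C = cn2 x.
Proof. by case: x => a b; rewrite /cn2 /= sqrrN. Qed.

Lemma cn2V x : cn2 x^-1 = (cn2 x)^-1.
Proof.
case: (eqVneq x 0) => [->|x0].
  by rewrite /cn2 invr0 /= !expr0n addr0 invr0.
apply: (mulfI (x := cn2 x)); first by rewrite cn2_eq0.
by rewrite -cn2M !mulfV ?cn2_eq0 // /cn2 /= expr1n expr0n addr0.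
Qed.

Lemma Re_invE x : Re x^-1 = cn2 x^-1 * Re x.
Proof. by rewrite cn2V Re_inv mulrC. Qed.

Lemma closed_poly_normal p :
  exists rs : seq C, p = lead_coef p *: \prod_(r <- rs) ('X - r%:P).
Proof.
have [rs ->] := closed_field_poly_normal p; exists rs.
by rewrite lead_coefZ (monicP (monic_prod_XsubC _ _ _)) mulr1.
Qed.

Lemma horner_prodXsubC (rs : seq C) x :
  (\prod_(r <- rs) ('X - r%:P)).[x] = \prod_(r <- rs) (x - r).
Proof. by rewrite horner_prod; apply: eq_bigr => r _; rewrite !hornerE. Qed.

Lemma deriv_prodXsubC (rs : seq C) x : x \notin rs ->
  (\prod_(r <- rs) ('X - r%:P))^`().[x]
  = (\prod_(r <- rs) (x - r)) * \sum_(r <- rs) (x - r)^-1.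
Proof.
elim: rs => [|r rs IH]; first by rewrite !big_nil derivC hornerE mulr0.
rewrite inE negb_or => /andP[xr xrs].
rewrite !big_cons derivM !hornerE derivXsubC IH // hornerE.
have -> : (\prod_(j <- rs) ('X - j%:P)).[x] = \prod_(r <- rs) (x - r).
  exact: horner_prodXsubC.
have : x - r != 0 by rewrite subr_eq0.
by move=> ?; field.
Qed.

Lemma deriv2_prodXsubC (rs : seq C) x : x \notin rs ->
  (\prod_(r <- rs) ('X - r%:P))^`()^`().[x]
  = (\prod_(r <- rs) (x - r)) *
    ((\sum_(r <- rs) (x - r)^-1) ^+ 2 - \sum_(r <- rs) (x - r)^-1 ^+ 2).
Proof.
elim: rs => [|r rs IH]; first by rewrite !big_nil derivC deriv0 hornerE expr0n /= subrr mulr0.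
rewrite inE negb_or => /andP[xr xrs].
have xr0 : x - r != 0 by rewrite subr_eq0.
rewrite !big_cons derivM derivXsubC mul1r derivD derivM derivXsubC mul1r.
rewrite !hornerD hornerM hornerXsubC IH // deriv_prodXsubC //.
by field.
Qed.

(** The logarithmic derivative at [x] is the sum of the [(x - r)^-1] over the roots. Each [x - r]
    has positive real part, so has its inverse, and the sum cannot vanish. *)
Lemma gauss_lucas_half_plane p : (1 < size p)%N ->
  (forall x, 0 <= Re x -> p.[x] != 0) ->
  forall x, 0 <= Re x -> p^`().[x] != 0.
Proof.
move=> sp hp x hx.
have [rs pE] := closed_poly_normal p.
have p0 : p != 0 by rewrite -size_poly_gt0 (ltn_trans _ sp).
have rsN r : r \in rs -> Re r < 0.
  move=> rin; rewrite ltNge; apply/negP => /hp; apply/negP; rewrite negbK.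
  by rewrite pE hornerZ horner_prodXsubC (big_rem r) //= subrr mul0r mulr0.
have xrs : x \notin rs by apply/negP => /rsN; rewrite ltNge hx.
have rs_ne : (0 < size rs)%N.
  by move: sp; rewrite pE size_scale ?lead_coef_eq0 // size_prod_XsubC.
rewrite pE derivZ hornerZ mulf_neq0 ?lead_coef_eq0 // deriv_prodXsubC //.
rewrite mulf_neq0 //.
  rewrite prodf_seq_neq0; apply/allP => r rin /=; rewrite subr_eq0.
  by apply: contraNneq xrs => ->.
apply: Re_neq0; rewrite Re_sum.
case: rs rs_ne rsN {pE xrs} => // r rs _ rsN.
rewrite big_cons ltr_pwDl //.
  by rewrite Re_inv_gt0 // ReB subr_gt0 (lt_le_trans (rsN _ _)) ?mem_head.
rewrite big_seq sumr_ge0 // => s sin.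
by rewrite ltW // Re_inv_gt0 // ReB subr_gt0 (lt_le_trans (rsN _ _)) // inE sin orbT.
Qed.

(** Coefficient [j] is, up to a factorial, the constant term of the j-th derivative, and Gauss-Lucas
    keeps the derivatives free of roots at 0. *)
Lemma half_plane_coef_neq0 j p : (j < size p)%N ->
  (forall x, 0 <= Re x -> p.[x] != 0) -> p`_j != 0.
Proof.
elim: j p => [|j IH] p sp hp; first by rewrite -horner_coef0 hp.
suff : p^`()`_j != 0 by apply: contraNneq; rewrite coef_deriv => ->; rewrite mul0rn.
apply: IH; last by apply: gauss_lucas_half_plane => //; apply: leq_ltn_trans sp.
have p0 : p != 0 by rewrite -size_poly_gt0 (leq_ltn_trans _ sp).
rewrite ltnNge; apply/negP => /leq_sizeP/(_ (size p).-2).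
rewrite coef_deriv; have -> : (size p).-2.+1 = (size p).-1 by lia.
move=> /(_ ltac:(lia)) /eqP; rewrite mulrn_eq0; apply/negP.
rewrite negb_or -lead_coefE lead_coef_eq0 p0 andbT; lia.
Qed.

(** Every root lies in the open left half-plane, hence is closer to -1 than to 1; there is at least
    one root, so the product inequality is strict. *)
Lemma hurwitz_reflection p : (1 < size p)%N ->
  (forall x, 0 <= Re x -> p.[x] != 0) -> cn2 p.[-1] < cn2 p.[1].
Proof.
move=> sp hp; have [rs pE] := closed_poly_normal p.
have p0 : p != 0 by rewrite -size_poly_gt0 (ltn_trans _ sp).
have rsN r : r \in rs -> Re r < 0.
  move=> rin; rewrite ltNge; apply/negP => /hp; apply/negP; rewrite negbK.
  by rewrite pE hornerZ horner_prodXsubC (big_rem r) //= subrr mul0r mulr0.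
have rs_ne : (0 < size rs)%N.
  by move: sp; rewrite pE size_scale ?lead_coef_eq0 // size_prod_XsubC.
rewrite pE !hornerZ !cn2M ltr_pM2l ?cn2_gt0 ?lead_coef_eq0 // !horner_prodXsubC.
have fac r : r \in rs -> cn2 (- 1 - r) < cn2 (1 - r).
  by move=> /rsN ha; rewrite /cn2 !ReB !ImD ReN !ImN /=; lra.
have prodE x : cn2 (\prod_(r <- rs) (x - r)) = \prod_(r <- rs) cn2 (x - r).
  elim: (rs) => [|r s IH]; last by rewrite !big_cons cn2M IH.
  by rewrite !big_nil /cn2 /= expr1n expr0n addr0.
rewrite !prodE; case: rs rs_ne fac {pE rsN prodE} => // r rs _ fac.
rewrite !big_cons; apply: (@le_lt_trans _ _ (cn2 (- 1 - r) * \prod_(j <- rs) cn2 (1 - j))).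
  rewrite ler_wpM2l ?cn2_ge0 // big_seq [leRHS]big_seq; apply: ler_prod => s sin.
  by rewrite cn2_ge0 ltW // fac // inE sin orbT.
rewrite ltr_pM2r ?fac ?mem_head // big_seq prodr_gt0 // => s sin.
by rewrite (le_lt_trans (cn2_ge0 _) (fac s _)) // inE sin orbT.
Qed.
End ComplexPoly.

(** * A variance bound from the location of the roots *)

Section HurwitzMoments.
Variable R : rcfType.
Local Notation C := R[i].
Local Notation toC := (real_complex R).

(** If [h] is the generating function of a random variable N, this says that N has at most twice the
    variance of a binomial law with [D] trials and the same mean. With c = 1 / (1 - r), Re r <= 0
    means |c|^2 <= Re c, so - Re (c^2) <= Re c - 2 (Re c)^2; Cauchy-Schwarz over the at most [D]
    roots produces the term in 2 / D. *)
Lemma hurwitz_deriv2_le (h : {poly R}) (D : nat) :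
  (0 < D)%N -> (size h <= D.+1)%N -> 0 < h.[1] ->
  (forall x : C, 0 < Re x -> (map_poly toC h).[x] != 0) ->
  h^`()^`().[1] * h.[1]
    <= h^`().[1] ^+ 2 + h.[1] * h^`().[1] - 2 / D%:R * h^`().[1] ^+ 2.
Proof.
move=> D0 sD h1 hroot; set p := map_poly toC h.
have pev (q : {poly R}) : (map_poly toC q).[1] = (q.[1])%:C%C.
  by rewrite -{1}(rmorph1 toC) horner_map.
have [rs pE] := closed_poly_normal p.
have p0 : p != 0.
  by apply/negP => /eqP p0; have := hroot 1 ltr01; rewrite -/p p0 horner0 eqxx.
have lp0 : lead_coef p != 0 by rewrite lead_coef_eq0.
have sz : (size rs <= D)%N.
  have : size p = (size rs).+1 by rewrite pE size_scale // size_prod_XsubC.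
  by rewrite size_map_poly => hsz; rewrite -ltnS -hsz.
have rsN r : r \in rs -> Re r <= 0.
  move=> rin; rewrite leNgt; apply/negP => /hroot; apply/negP; rewrite negbK -/p.
  by rewrite pE hornerZ horner_prodXsubC (big_rem r) //= subrr mul0r mulr0.
have rs1 : 1 \notin rs by apply/negP => /rsN /=; rewrite leNgt ltr01.
set c := fun r : C => (1 - r)^-1.
set S1 := \sum_(r <- rs) c r; set S2 := \sum_(r <- rs) c r ^+ 2.
have e1 : (h^`().[1])%:C%C = (h.[1])%:C%C * S1.
  rewrite -!pev -deriv_map -/p pE derivZ !hornerZ deriv_prodXsubC //.
  by rewrite horner_prodXsubC mulrA.
have e2 : (h^`()^`().[1])%:C%C = (h.[1])%:C%C * (S1 ^+ 2 - S2).
  rewrite -!pev -!deriv_map -/p pE !derivZ !hornerZ deriv2_prodXsubC //.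
  by rewrite horner_prodXsubC mulrA.
set s := \sum_(r <- rs) Re (c r).
have ReS1 : Re S1 = s by rewrite Re_sum.
have h1E : h^`().[1] = h.[1] * s.
  by have := congr1 Re e1; rewrite ReM /= mul0r subr0 ReS1.
have ImS1 : Im S1 = 0.
  have := congr1 Im e1; rewrite ImM /= mul0r addr0 => /esym/eqP.
  by rewrite mulf_eq0 (gt_eqF h1) /= => /eqP.
have h2E : h^`()^`().[1] = h.[1] * (s ^+ 2 - Re S2).
  have := congr1 Re e2; rewrite ReM /= mul0r subr0 ReB expr2 ReM ReS1 ImS1.
  by rewrite mul0r subr0 -expr2.
have cle r : r \in rs -> cn2 (c r) <= Re (c r).
  move=> /rsN rle; rewrite [leRHS]Re_invE -/(c r) -[leLHS]mulr1.
  by rewrite ler_wpM2l ?cn2_ge0 // ReB /=; lra.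
have S2le : - Re S2 <= \sum_(r <- rs) (Re (c r) - 2 * Re (c r) ^+ 2).
  rewrite Re_sum -sumrN big_seq [leRHS]big_seq; apply: ler_sum => r /cle.
  by rewrite /cn2 !expr2 ReM; lra.
have CS : s ^+ 2 / D%:R <= \sum_(r <- rs) Re (c r) ^+ 2.
  have DR : 0 < D%:R :> R by rewrite ltr0n.
  have : 0 <= \sum_(r <- rs) (Re (c r) - s / D%:R) ^+ 2.
    by rewrite sumr_ge0 // => r _; rewrite sqr_ge0.
  have -> : \sum_(r <- rs) (Re (c r) - s / D%:R) ^+ 2 =
     \sum_(r <- rs) Re (c r) ^+ 2 - 2 * (s / D%:R) * s + (size rs)%:R * (s / D%:R) ^+ 2.
    have -> : (size rs)%:R * (s / D%:R) ^+ 2 = \sum_(r <- rs) (s / D%:R) ^+ 2.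
      by rewrite big_const_seq count_predT iter_addr_0 mulr_natl.
    have -> : 2 * (s / D%:R) * s = \sum_(r <- rs) 2 * (s / D%:R) * Re (c r).
      by rewrite -mulr_sumr.
    by rewrite -sumrB -big_split /=; apply: eq_bigr => r _; ring.
  have : (size rs)%:R * (s / D%:R) ^+ 2 <= D%:R * (s / D%:R) ^+ 2.
    by rewrite ler_wpM2r ?sqr_ge0 // ler_nat.
  have -> : D%:R * (s / D%:R) ^+ 2 = s ^+ 2 / D%:R by field; rewrite gt_eqF.
  have -> : 2 * (s / D%:R) * s = 2 * (s ^+ 2 / D%:R) by ring.
  lra.
rewrite h2E h1E.
have -> : h.[1] * (s ^+ 2 - Re S2) * h.[1] = h.[1] ^+ 2 * (s ^+ 2 - Re S2) by ring.
have -> : (h.[1] * s) ^+ 2 + h.[1] * (h.[1] * s) - 2 / D%:R * (h.[1] * s) ^+ 2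
  = h.[1] ^+ 2 * (s ^+ 2 + s - 2 * (s ^+ 2 / D%:R)) by ring.
rewrite ler_wpM2l ?sqr_ge0 //.
have : \sum_(r <- rs) (Re (c r) - 2 * Re (c r) ^+ 2)
   = s - 2 * \sum_(r <- rs) Re (c r) ^+ 2 by rewrite sumrB -mulr_sumr.
lra.
Qed.
End HurwitzMoments.

(** * A Schwarz lemma for the slit plane *)

Section Homotopy.
Variable R : realType.
Local Notation C := R[i].
Local Notation toC := (real_complex R).
Local Notation nm := (@Normc.normc R).
Implicit Types (x y z : C) (p q : {poly C}).

Lemma nmE x : `|x| = (nm x)%:C%C.
Proof. by rewrite normc_def; case: x. Qed.

Lemma nm_le x (r : R) : (nm x <= r) = (`|x| <= r%:C%C).
Proof. by rewrite nmE lecR. Qed.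

Lemma nm_ge0 x : 0 <= nm x.
Proof. by rewrite -ler0c -nmE. Qed.

Lemma nmD x y : nm (x + y) <= nm x + nm y.
Proof. by rewrite nm_le rmorphD /= -!nmE ler_normD. Qed.

Lemma nmN x : nm (- x) = nm x.
Proof. by apply: complexI; rewrite -!nmE normrN. Qed.

Lemma nmB x y : nm x - nm y <= nm (x - y).
Proof. by rewrite lerBlDr -{1}(subrK y x) nmD. Qed.

Lemma nmM x y : nm (x * y) = nm x * nm y.
Proof. exact: Normc.normcM. Qed.

Lemma nm_eq0 x : (nm x == 0) = (x == 0).
Proof. by rewrite -(inj_eq (@complexI R)) -nmE normr_eq0. Qed.

Lemma nm_gt0 x : (0 < nm x) = (x != 0).
Proof. by rewrite lt0r nm_eq0 nm_ge0 andbT. Qed.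

Lemma nm_real (r : R) : nm (r%:C%C) = `|r|.
Proof. by rewrite /= expr0n addr0 sqrtr_sqr. Qed.

Lemma nm_sqr x : nm x ^+ 2 = cn2 x.
Proof. by case: x => a b; rewrite /cn2 sqr_sqrtr // addr_ge0 ?sqr_ge0. Qed.

Lemma nm_prod (I : Type) (r : seq I) (F : I -> C) :
  nm (\prod_(i <- r) F i) = \prod_(i <- r) nm (F i).
Proof.
by elim/big_rec2: _ => [|i a b _ <-]; [rewrite Normc.normc1|rewrite nmM].
Qed.

Lemma root_factor p : p != 0 -> exists rs : seq C,
  p = lead_coef p *: \prod_(r <- rs) ('X - r%:P) /\ (forall r, r \in rs -> root p r).
Proof.
move=> p0; have [rs pE] := closed_poly_normal p; exists rs; split=> // r rin.
by rewrite pE /root hornerZ horner_prodXsubC (big_rem r) //= subrr mul0r mulr0.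
Qed.

(* Replaces the continuity of roots: a polynomial that is small at [x] and not
   small at [y] has a root near [x]. *)
Lemma no_root_bound q x y (d : R) n : 0 < d -> (size q <= n.+1)%N ->
  (forall r, root q r -> d <= nm (x - r)) ->
  nm q.[y] <= nm q.[x] * (1 + nm (y - x) / d) ^+ n.
Proof.
move=> d0 sq hr; have [->|q0] := eqVneq q 0.
  by rewrite !horner0 Normc.normc0 mul0r.
have [rs [qE rsR]] := root_factor q0.
have M1 : 1 <= 1 + nm (y - x) / d by rewrite lerDl divr_ge0 ?nm_ge0 // ltW.
have srs : (size rs <= n)%N.
  by rewrite -ltnS (leq_trans _ sq) // [in leqRHS]qE size_scale ?lead_coef_eq0 // size_prod_XsubC.
rewrite qE !hornerZ !nmM !horner_prodXsubC !nm_prod -mulrA ler_wpM2l ?nm_ge0 //.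
apply: (@le_trans _ _ (\prod_(r <- rs) (nm (x - r) * (1 + nm (y - x) / d)))).
  rewrite big_seq [leRHS]big_seq; apply: ler_prod => r /rsR/hr dr.
  rewrite nm_ge0 /= mulrDr mulr1.
  have -> : y - r = (x - r) + (y - x) by ring.
  apply: le_trans (nmD _ _) _; rewrite lerD2l mulrCA ler_peMr ?nm_ge0 //.
  by rewrite ler_pdivlMr // mul1r.
rewrite big_split /= ler_wpM2l //.
  by rewrite prodr_ge0 // => r _; exact: nm_ge0.
rewrite big_const_seq count_predT iter_mulr mulr1.
exact: ler_weXn2l.
Qed.

Lemma lipschitz_on_disc p : exists K : R, 0 <= K /\
  (forall x, nm x <= 1 -> nm p.[x] <= K) /\
  (forall x y, nm x <= 1 -> nm y <= 1 -> nm (p.[x] - p.[y]) <= K * nm (x - y)).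
Proof.
elim/poly_ind: p => [|p c [K [K0 [Kb Kl]]]].
  exists 0; split => //; split => [x _|x y _ _]; rewrite ?horner0 ?subrr Normc.normc0 //.
  by rewrite mul0r.
exists (K + K + nm c); split; first by rewrite !addr_ge0 ?nm_ge0.
split=> [x hx|x y hx hy].
  rewrite !hornerE; apply: le_trans (nmD _ _) _; rewrite lerD2r nmM.
  have := Kb x hx; have := nm_ge0 p.[x]; nra.
rewrite !hornerE.
have -> : p.[x] * x + c - (p.[y] * y + c) = (p.[x] - p.[y]) * x + p.[y] * (x - y) by ring.
apply: le_trans (nmD _ _) _; rewrite !nmM.
have h1 : nm (p.[x] - p.[y]) * nm x <= K * nm (x - y).
  by apply: le_trans (Kl x y hx hy); rewrite ler_piMr ?nm_ge0.
have h2 : nm p.[y] * nm (x - y) <= K * nm (x - y) by rewrite ler_wpM2r ?nm_ge0 ?Kb.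
have h3 : 0 <= nm c * nm (x - y) by rewrite mulr_ge0 ?nm_ge0.
by rewrite !mulrDl; lra.
Qed.

(** Stands for compactness of the disc: every root has modulus above 1, and its factor is at least
    [nm r - 1] on the disc. *)
Lemma no_root_lower_bound p : (forall x, nm x <= 1 -> p.[x] != 0) ->
  exists c : R, 0 < c /\ forall x, nm x <= 1 -> c <= nm p.[x].
Proof.
move=> hp; have p0 : p != 0.
  apply: contraTneq (hp 0 _) => [->|]; rewrite ?horner0 ?eqxx //.
  by rewrite Normc.normc0.
have [rs [pE rsR]] := root_factor p0.
have rs1 r : r \in rs -> 1 < nm r.
  by move=> /rsR pr; rewrite ltNge; apply/negP => /hp; rewrite -rootE pr.
exists (nm (lead_coef p) * \prod_(r <- rs) (nm r - 1)); split.
  rewrite mulr_gt0 ?nm_gt0 ?lead_coef_eq0 // big_seq prodr_gt0 // => r /rs1.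
  by rewrite subr_gt0.
move=> x hx; rewrite pE hornerZ nmM lead_coefZ (monicP (monic_prod_XsubC _ _ _)) mulr1.
rewrite ler_wpM2l ?nm_ge0 // horner_prodXsubC nm_prod big_seq [leRHS]big_seq.
apply: ler_prod => r /rs1 hr; rewrite subr_ge0 (ltW hr) /=.
rewrite -[nm (x - r)]nmN opprB; have := nmB r x; lra.
Qed.

(** Let [e0] be the infimum of the parameters with a root in the disc. If [U e0] has such a root, it
    is interior, and just below [e0] the polynomial would be tiny at that point without having any
    root nearby, against [no_root_bound]. If it has none, [U e0] is bounded away from 0 on the disc,
    and so are its neighbours, against the definition of the infimum. *)
Lemma no_root_homotopy (U : R -> {poly C}) (e1 K : R) (n : nat) :
  0 <= e1 -> 0 <= K -> (forall e, (size (U e) <= n.+1)%N) ->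
  (forall e e' z, 0 <= e <= e1 -> 0 <= e' <= e1 -> nm z <= 1 ->
     nm ((U e).[z] - (U e').[z]) <= K * `|e - e'|) ->
  (forall e z, 0 <= e <= e1 -> nm z = 1 -> (U e).[z] != 0) ->
  (forall z, nm z <= 1 -> (U 0).[z] != 0) ->
  forall z, nm z <= 1 -> (U e1).[z] != 0.
Proof.
move=> e1_0 K0 sU UK Ucirc U0 z1 hz1; apply/negP => /eqP Uz1.
pose E := [set e : R | 0 <= e <= e1 /\ exists2 z, nm z <= 1 & (U e).[z] = 0]%classic.
have E1 : E e1 by split; [rewrite e1_0 lexx | exists z1].
have hE : has_inf E by split; [exists e1 | exists 0 => e [/andP[]]].
set e0 := inf E.
have e0_0 : 0 <= e0 by apply: lb_le_inf; [exists e1 | move=> e [/andP[]]].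
have e01 : e0 <= e1 by apply: ge_inf E1; exact: hE.2.
have e0in : 0 <= e0 <= e1 by rewrite e0_0.
have [[z0 hz0 Uz0]|noroot] := pselect (exists2 z, nm z <= 1 & (U e0).[z] = 0).
  have e0gt : 0 < e0.
    rewrite lt_neqAle e0_0 andbT; apply/eqP => e00.
    by have := U0 z0 hz0; rewrite e00 Uz0 eqxx.
  have z0lt : nm z0 < 1.
    rewrite lt_neqAle hz0 andbT; apply/eqP => /(Ucirc _ _ e0in).
    by rewrite Uz0 eqxx.
  (* [M] is the growth allowed by [no_root_bound] from [z0] to the boundary point 1: below [e0] all
     roots have modulus above 1, hence stay at distance at least [1 - nm z0] from [z0]. *)
  set M := (1 + nm (1 - z0) / (1 - nm z0)) ^+ n.
  have M0 : 0 <= M by rewrite exprn_ge0 // addr_ge0 // divr_ge0 ?nm_ge0 // subr_ge0.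
  have nm1 : nm 1 = 1 by rewrite Normc.normc1.
  have w0 : 0 < nm (U e0).[1] by rewrite nm_gt0 Ucirc.
  set w := nm (U e0).[1] in w0.
  (* Going down by [t] changes values by at most [K * t], so [no_root_bound] will give
     [w <= K * t * (M + 1)]; the choice [t <= w / (2 * D)] contradicts this. *)
  set D := K * (M + 1) + 1.
  have D0 : 0 < D by rewrite /D; nra.
  set t := Num.min e0 (w / (2 * D)).
  have t0 : 0 < t by rewrite lt_min e0gt divr_gt0 // mulr_gt0.
  have te : t <= e0 by rewrite ge_min lexx.
  have tw : t * (2 * D) <= w by rewrite -ler_pdivlMr ?mulr_gt0 // ge_min lexx orbT.
  have ein : 0 <= e0 - t <= e1 by apply/andP; split; lra.
  have tE : `|e0 - (e0 - t)| = t by rewrite opprB addrC subrK gtr0_norm.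
  have noR r : root (U (e0 - t)) r -> 1 - nm z0 <= nm (z0 - r).
    move=> /rootP Ur; have : 1 < nm r.
      rewrite ltNge; apply/negP => hr.
      have : e0 <= e0 - t by apply: ge_inf; [exact: hE.2 | split => //; exists r].
      lra.
    have := nmB r z0; rewrite -[nm (z0 - r)]nmN opprB; lra.
  have d0 : 0 < 1 - nm z0 by rewrite subr_gt0.
  have b1 := no_root_bound 1 d0 (sU _) noR.
  have b2 := UK _ _ 1 e0in ein (eq_ind_r (fun v => v <= 1) (lexx 1) nm1).
  have b3 := UK _ _ z0 e0in ein hz0.
  rewrite tE in b2 b3; rewrite Uz0 sub0r nmN in b3.
  have b4 := nmB (U e0).[1] (U (e0 - t)).[1].
  have b5 : nm (U (e0 - t)).[z0] * M <= K * t * M by rewrite ler_wpM2r.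
  rewrite -/M -/w in b1 b4 b5.
  have : w <= K * t * M + K * t by lra.
  have -> : K * t * M + K * t = t * (D - 1) by rewrite /D; ring.
  have : 0 < t * D by rewrite mulr_gt0.
  lra.
have [|c [c0 hc]] := @no_root_lower_bound (U e0).
  by move=> z hz; apply/negP => /eqP Uz; apply: noroot; exists z.
have d0 : 0 < c / (K + 1) by rewrite divr_gt0 // ltr_wpDl.
have [e [ein [z hz Uz]] ehi] := inf_adherent d0 hE.
have elo : e0 <= e by apply: ge_inf; [exact: hE.2 | split => //; exists z].
have := UK _ _ z e0in ein hz; rewrite Uz subr0 distrC ger0_norm ?subr_ge0 //.
have := hc z hz; rewrite -/e0 in ehi.
have : (e - e0) * (K + 1) < c by rewrite -ltr_pdivlMr ?ltr_wpDl // ltrBlDl.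
have : 0 <= e - e0 by rewrite subr_ge0.
lra.
Qed.
End Homotopy.

Section CayleyTransform.
Variable R : realType.
Local Notation C := R[i].
Local Notation toC := (real_complex R).
Local Notation nm := (@Normc.normc R).

(** The Moebius map (1 + z) / (1 - z) sends the disc to the right half-plane and 0 to 1; this is [p]
    composed with it, cleared of denominators. Since [n] bounds the size and not the degree, a spare
    factor [1 - 'X] is present. *)
Definition cayley (n : nat) (p : {poly R}) : {poly R} :=
  \sum_(j < n) p`_j *: ((1 + 'X) ^+ j * (1 - 'X) ^+ (n - j)).

Lemma horner_cayley n (p : {poly R}) (z : C) : (size p <= n)%N -> z != 1 ->
  (map_poly toC (cayley n p)).[z]
  = (1 - z) ^+ n * (map_poly toC p).[(1 + z) / (1 - z)].
Proof.
move=> sp z1; have z1' : 1 - z != 0 by rewrite subr_eq0 eq_sym.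
rewrite [(map_poly toC p).[_]](@horner_coef_wide _ n) ?size_map_poly // mulr_sumr.
rewrite /cayley rmorph_sum /= horner_sum; apply: eq_bigr => j _.
rewrite map_polyZ /= hornerZ rmorphM !rmorphXn /= rmorphD rmorphB /= rmorph1 map_polyX.
rewrite hornerM !horner_exp !hornerE coef_map /= -!mulrA [RHS]mulrCA; congr (_ * _).
have -> : (1 - z) ^+ n = (1 - z) ^+ j * (1 - z) ^+ (n - j).
  by rewrite -exprD subnKC // ltnW.
by rewrite expr_div_n mulrAC mulrCA mulfV ?mulr1 // expf_neq0.
Qed.

Lemma cayley0 n (p : {poly R}) : (size p <= n)%N -> (cayley n p).[0] = p.[1].
Proof.
move=> sp; rewrite [p.[1]](@horner_coef_wide _ n) // /cayley horner_sum.
apply: eq_bigr => j _; rewrite hornerZ hornerM !horner_exp !(hornerD, hornerN, hornerX, hornerC).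
by rewrite addr0 subr0 !expr1n !mulr1.
Qed.

Lemma deriv_cayley0 n (p : {poly R}) : (size p <= n)%N ->
  (cayley n p)^`().[0] = 2 * p^`().[1] - n%:R * p.[1].
Proof.
move=> sp.
have sE : p = \sum_(j < n) p`_j *: 'X^j.
  rewrite -[LHS]coefK poly_def (big_ord_widen n (fun i => p`_i *: 'X^i)) //.
  rewrite big_mkcond /=; apply: eq_bigr => i _.
  by case: ltnP => // h; rewrite nth_default ?scale0r.
have -> : p^`().[1] = \sum_(j < n) p`_j * j%:R.
  rewrite [in LHS]sE (big_morph _ (@derivD R) (@deriv0 R)) horner_sum; apply: eq_bigr => j _.
  by rewrite derivZ hornerZ derivXn hornerMn hornerXn expr1n.
rewrite [p.[1]](@horner_coef_wide _ n) // !mulr_sumr -sumrB /cayley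
  (big_morph _ (@derivD R) (@deriv0 R)) horner_sum.
apply: eq_bigr => j _.
rewrite derivZ hornerZ derivM !deriv_exp hornerD !hornerM !hornerMn !hornerM.
rewrite !horner_exp derivD derivB derivX derivC
  !(hornerD, hornerN, hornerX, hornerC, addr0, subr0) !expr1n.
have -> : n%:R = j%:R + (n - j)%:R :> R by rewrite -natrD subnKC // ltnW.
ring.
Qed.

Lemma size_comp_scaleX (p : {poly C}) (c : C) :
  (size (p \Po (c *: 'X)) <= size p + 1)%N.
Proof.
apply: leq_trans (size_comp_poly_leq _ _) _.
have : (size (c *: 'X) <= 2)%N by rewrite (leq_trans (size_scale_leq _ _)) // size_polyX.
move: (size (c *: 'X)) (size p) => [|[|[|u]]] v //= _.
- by rewrite muln0 addn1.
- by rewrite muln0 addn1.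
- by rewrite muln1 addn1 ltnS leq_pred.
Qed.

Lemma size_family_leq (p q : {poly C}) (c d : C) :
  (size (c *: ((1 + 'X ^+ 2) * (p \Po (c *: 'X))) - d *: (q \Po (c *: 'X)))%R
   <= (size p + size q + 5).+1)%N.
Proof.
have h1 : (size ((1 + 'X ^+ 2)%R : {poly C}) <= 3)%N.
  by rewrite (leq_trans (size_polyD _ _)) // size_polyXn size_poly1.
rewrite (leq_trans (size_polyD _ _)) // size_polyN geq_max; apply/andP; split.
  apply: leq_trans (size_scale_leq _ _) _; apply: leq_trans (size_polyMleq _ _) _.
  apply: leq_trans (leq_pred _) _; apply: leq_trans (leq_add h1 (size_comp_scaleX _ _)) _.
  by move: (size p) (size q) => u v; lia.
apply: leq_trans (size_scale_leq _ _) _; apply: leq_trans (size_comp_scaleX _ _) _.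
by move: (size p) (size q) => u v; lia.
Qed.

(* On the half-plane [a / b] avoids the negative real axis, so its square root
   has positive real part and the Schwarz lemma bounds the logarithmic
   derivative of [a / b] at 1 by 2.  The square root is avoided: in disc
   coordinates, [sqrt (a / b) = (1 + w) / (1 - w)] with [w = z / e] reads
   [a (1 - w)^2 = b (1 + w)^2], an equation that has no solution [|w| = 1] for
   [e < 1], and whose only solution in the disc is [w = 0] for [e = 0]. *)
Lemma schwarz_slit_plane (a b : {poly R}) : 0 < a.[1] -> 0 < b.[1] ->
  (forall x : C, 0 < Re x -> forall c : R, 0 <= c ->
     (map_poly toC a).[x] + c%:C%C * (map_poly toC b).[x] != 0) ->
  (forall x : C, 0 < Re x -> (map_poly toC b).[x] != 0) ->
  a^`().[1] * b.[1] - a.[1] * b^`().[1] <= 2 * (a.[1] * b.[1]).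
Proof.
move=> a1 b1 hab hb.
pose n := maxn (size a) (size b).
have sa : (size a <= n)%N by rewrite leq_maxl.
have sb : (size b <= n)%N by rewrite leq_maxr.
set g := a.[1] * b.[1]; have g0 : 0 < g by rewrite mulr_gt0.
pose A := b.[1] *: cayley n a; pose B := a.[1] *: cayley n b.
have A0 : A.[0] = g by rewrite hornerZ cayley0 // mulrC.
have B0 : B.[0] = g by rewrite hornerZ cayley0.
have [E EE] : exists E, A - B = E * 'X.
  by apply/dvdpP; rewrite -['X]subr0 -polyC0 dvdp_XsubCl rootE hornerD hornerN A0 B0 subrr.
(* The scaling by [b.[1]] and [a.[1]] makes [A] and [B] agree at 0 and cancels the terms in [n] of
   the two derivatives. *)
have E0 : E.[0] = 2 * (a^`().[1] * b.[1] - a.[1] * b^`().[1]).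
  have := congr1 (fun q => q^`().[0]) EE.
  rewrite derivB derivM derivX !hornerE => <-.
  rewrite /A /B !derivZ !hornerZ !deriv_cayley0 //; ring.
rewrite leNgt; apply/negP => hlt.
have {}E0 : 4 * g < E.[0] by rewrite E0; lra.
(* The value at 0 of the family [U] below is [e * E.[0] - 4 * g]; [e1] is the parameter where it
   vanishes, and the negated bound makes it smaller than 1. *)
pose e1 := 4 * g / E.[0].
have E00 : 0 < E.[0] by apply: lt_trans E0; lra.
have e1_0 : 0 < e1 by rewrite divr_gt0 //; lra.
have e1_1 : e1 < 1 by rewrite ltr_pdivrMr // mul1r.
pose Ec := map_poly toC E; pose Ac := map_poly toC A; pose Bc := map_poly toC B.
pose s := Ac + Bc.
pose sc (e : R) : {poly C} := e%:C%C *: 'X.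
pose U e := e%:C%C *: ((1 + 'X ^+ 2) * (Ec \Po sc e)) - 2 *: (s \Po sc e).
have Uev e z : (U e).[z]
    = e%:C%C * (1 + z ^+ 2) * Ec.[e%:C%C * z] - 2 * s.[e%:C%C * z].
  rewrite /U /sc hornerD hornerN !hornerZ hornerM !horner_comp hornerZ hornerX.
  by rewrite hornerD hornerC hornerXn mulrA.
have [K1 [K1_0 [K1b K1l]]] := lipschitz_on_disc Ec.
have [K2 [K2_0 [K2b K2l]]] := lipschitz_on_disc s.
have nmsc e z : 0 <= e <= e1 -> nm z <= 1 -> nm (e%:C%C * z) <= e.
  move=> /andP[he _] hz; rewrite nmM nm_real ger0_norm //.
  by rewrite ler_piMr.
have AB z : Ac.[z] - Bc.[z] = Ec.[z] * z.
  have := congr1 (fun q => (map_poly toC q).[z]) EE.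
  by rewrite rmorphB rmorphM /= map_polyX !hornerE.
have A0c : Ac.[0] = g%:C%C by rewrite -A0 -horner_map rmorph0.
have B0c : Bc.[0] = g%:C%C by rewrite -B0 -horner_map rmorph0.
have Uspec e z : z * (U e).[z]
    = Ac.[e%:C%C * z] * (1 - z) ^+ 2 - Bc.[e%:C%C * z] * (1 + z) ^+ 2.
  rewrite Uev /s hornerD.
  have -> : Ac.[e%:C%C * z] = Bc.[e%:C%C * z] + Ec.[e%:C%C * z] * (e%:C%C * z).
    by rewrite -AB addrC subrK.
  by ring.
have Ecay z : nm z < 1 -> 0 < Re ((1 + z) / (1 - z)).
  move=> hz; have hz2 : cn2 z < 1 by rewrite -nm_sqr expr_lt1 ?nm_ge0.
  have z1 : 1 - z != 0.
    by rewrite subr_eq0; apply: contraTneq hz => <-; rewrite Normc.normc1 ltxx.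
  have -> : (1 + z) / (1 - z) = (1 - z)^-1 + (1 - z)^-1 - 1 by field.
  have n0 : 0 < cn2 (1 - z) by rewrite cn2_gt0.
  rewrite ReB ReD Re_inv -/(cn2 _) -mulrDl subr_gt0 /= ltr_pdivlMr // mul1r.
  by move: hz2; rewrite /cn2 !ReB !ImD !ImN /=; lra.
have e1in : 0 <= e1 by apply: ltW.
have main : forall z, nm z <= 1 -> (U e1).[z] != 0.
  apply: (@no_root_homotopy R U e1 (2 * K1 + 2 * K1 + 2 * K2) (size Ec + size s + 5)) => //.
  - by rewrite !addr_ge0 // mulr_ge0.
  - by move=> e; apply: size_family_leq.
  - move=> e e' z he he' hz; rewrite !Uev.
    have ne := nmsc e z he hz; have ne' := nmsc e' z he' hz.
    have le1 : nm (e%:C%C * z) <= 1 by apply: le_trans ne _; lra.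
    have le1' : nm (e'%:C%C * z) <= 1 by apply: le_trans ne' _; lra.
    have nd : nm (e%:C%C * z - e'%:C%C * z) <= `|e - e'|.
      by rewrite -mulrBl -rmorphB /= nmM nm_real ler_piMr.
    have n2 : nm (1 + z ^+ 2) <= 2.
      apply: le_trans (nmD _ _) _; rewrite Normc.normc1 expr2 nmM.
      have := nm_ge0 z; nra.
    have -> : e%:C%C * (1 + z ^+ 2) * Ec.[e%:C%C * z] - 2 * s.[e%:C%C * z]
       - (e'%:C%C * (1 + z ^+ 2) * Ec.[e'%:C%C * z] - 2 * s.[e'%:C%C * z])
      = (e%:C%C - e'%:C%C) * (1 + z ^+ 2) * Ec.[e%:C%C * z]
        + (e'%:C%C * (1 + z ^+ 2) * (Ec.[e%:C%C * z] - Ec.[e'%:C%C * z])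
        - 2 * (s.[e%:C%C * z] - s.[e'%:C%C * z])) by ring.
    set d := `|e - e'| in nd *.
    have d0 : 0 <= d by rewrite normr_ge0.
    have t1 : nm ((e%:C%C - e'%:C%C) * (1 + z ^+ 2) * Ec.[e%:C%C * z]) <= d * 2 * K1.
      have -> : e%:C%C - e'%:C%C = (e - e')%:C%C by rewrite rmorphB.
      rewrite !nmM nm_real -/d.
      by rewrite ler_pM ?mulr_ge0 ?nm_ge0 ?K1b // ler_wpM2l.
    have t2 : nm (e'%:C%C * (1 + z ^+ 2) * (Ec.[e%:C%C * z] - Ec.[e'%:C%C * z])) <= 1 * 2 * (K1 * d).
      rewrite !nmM nm_real.
      rewrite ler_pM ?mulr_ge0 ?nm_ge0 ?normr_ge0 //.
        rewrite ler_pM ?nm_ge0 ?normr_ge0 // ger0_norm; lra.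
      by apply: le_trans (K1l _ _ le1 le1') _; rewrite ler_wpM2l.
    have t3 : nm (2 * (s.[e%:C%C * z] - s.[e'%:C%C * z])) <= 2 * (K2 * d).
      have -> : (2 : C) = (2 : R)%:C%C by rewrite rmorph_nat.
      rewrite nmM nm_real ger0_norm // ler_wpM2l //.
      by apply: le_trans (K2l _ _ le1 le1') _; rewrite ler_wpM2l.
    apply: le_trans (nmD _ _) _; apply: le_trans (lerD t1 (nmD _ _)) _.
    rewrite nmN; lra.
  - move=> e z he hz; apply/negP => /eqP Uz.
    have hx : nm (e%:C%C * z) < 1.
      by apply: le_lt_trans (nmsc _ _ he _) _; rewrite ?hz //; lra.
    set x := e%:C%C * z in hx.
    have x1 : x != 1.
      by apply: contraTneq hx => ->; rewrite Normc.normc1 ltxx.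
    have ReX := Ecay _ hx.
    have := Uspec e z; rewrite Uz mulr0 -/x => /esym/eqP; rewrite subr_eq0 => /eqP AzB.
    have x1n : (1 - x) ^+ n != 0 by rewrite expf_neq0 // subr_eq0 eq_sym.
    have Acx : Ac.[x] = (b.[1])%:C%C * ((1 - x) ^+ n * (map_poly toC a).[(1 + x) / (1 - x)]).
      by rewrite /Ac /A map_polyZ /= hornerZ horner_cayley.
    have Bcx : Bc.[x] = (a.[1])%:C%C * ((1 - x) ^+ n * (map_poly toC b).[(1 + x) / (1 - x)]).
      by rewrite /Bc /B map_polyZ /= hornerZ horner_cayley.
    have a1c : (a.[1])%:C%C != 0 by rewrite fmorph_eq0 gt_eqF.
    have b1c : (b.[1])%:C%C != 0 by rewrite fmorph_eq0 gt_eqF.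
    have Bx0 : Bc.[x] != 0 by rewrite Bcx !mulf_neq0 ?hb.
    have [z1|z1] := eqVneq z 1.
      move: AzB; rewrite z1 subrr expr0n /= mulr0 => /esym/eqP.
      by rewrite mulf_eq0 (negPf Bx0) expf_eq0 /= -mulr2n pnatr_eq0.
    have zn : Re z ^+ 2 + Im z ^+ 2 = 1 by rewrite -/(cn2 z) -nm_sqr hz expr1n.
    have rez : Re z < 1.
      rewrite lt_neqAle; apply/andP; split; last by nra.
      apply: contraNneq z1 => rz; rewrite eq_complex /= rz eqxx /=.
      by move: zn; rewrite rz; move=> ?; rewrite -sqrf_eq0; apply/eqP; lra.
    (* On the unit circle ((1 + z) / (1 - z))^2 is a nonpositive real. So a root there makes [Ac] a
       nonpositive multiple of [Bc], which is what [hab] forbids. *)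
    have key : (1 + z) ^+ 2 * (1 - Re z)%:C%C = - ((1 + Re z)%:C%C * (1 - z) ^+ 2).
      apply/eqP; move: zn; case: z {hz Uz hx x1 ReX AzB x1n Acx Bcx Bx0 z1 rez x} => u v /= zn.
      rewrite eq_complex !expr2; apply/andP; split; apply/eqP.
        by rewrite !(ReM, ReN, ImM, ReD, ImD, ImN) /=; nra.
      by rewrite !(ReM, ImN, ImM, ReD, ImD, ReN) /=; nra.
    have zz : (1 - z) ^+ 2 != 0 by rewrite expf_neq0 // subr_eq0 eq_sym.
    have : Ac.[x] * (1 - Re z)%:C%C + (1 + Re z)%:C%C * Bc.[x] = 0.
      apply: (mulIf zz); rewrite mul0r.
      have -> : (Ac.[x] * (1 - Re z)%:C%C + (1 + Re z)%:C%C * Bc.[x]) * (1 - z) ^+ 2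
        = Ac.[x] * (1 - z) ^+ 2 * (1 - Re z)%:C%C + (1 + Re z)%:C%C * Bc.[x] * (1 - z) ^+ 2.
        by ring.
      by rewrite AzB -(mulrA Bc.[x]) key; ring.
    rewrite Acx Bcx.
    have c0 : 0 <= (1 + Re z) * a.[1] / ((1 - Re z) * b.[1]).
      have rz1 : 0 <= 1 + Re z by have := sqr_ge0 (Im z); nra.
      by rewrite divr_ge0 // mulr_ge0 // ltW // subr_gt0.
    have rz0 : (1 - Re z)%:C%C != 0 by rewrite fmorph_eq0 subr_eq0 gt_eqF.
    have := hab _ ReX _ c0; rewrite rmorphM fmorphV !rmorphM /=.
    set fa := (map_poly toC a).[_]; set fb := (map_poly toC b).[_].
    move=> hne hz0; move/eqP: hne; apply.
    apply: (mulfI (mulf_neq0 (mulf_neq0 rz0 b1c) x1n)); rewrite mulr0 -[RHS]hz0.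
    field; apply/andP; split; first exact: b1c.
    by move: rz0; rewrite rmorphB rmorph1.
  - move=> z _; rewrite Uev rmorph0 !mul0r sub0r oppr_eq0 mulf_neq0 //.
      by rewrite pnatr_eq0.
    by rewrite /s hornerD A0c B0c -rmorphD /= fmorph_eq0 gt_eqF // addr_gt0.
have := main 0; rewrite Normc.normc0 ler01 => /(_ isT); rewrite Uev mulr0.
rewrite /s hornerD A0c B0c expr0n /= addr0 mulr1.
have -> : Ec.[0] = (E.[0])%:C%C by rewrite -horner_map rmorph0.
rewrite -rmorphM -rmorphD /= -[2](rmorph_nat toC) -rmorphM -rmorphB /= fmorph_eq0.
rewrite /e1 divfK; last by rewrite gt_eqF.
by move=> /negP; apply; apply/eqP; ring.
Qed.
End CayleyTransform.

(** * Stability of slices on a sector *)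

Section DetExpansion.
Variable K : comNzRingType.

Lemma det_mxsub_bij (m n : nat) (f : 'I_m -> 'I_n) (A : 'M[K]_n) :
  bijective f -> \det (mxsub f f A) = \det A.
Proof.
move=> bf; have mn : m = n by rewrite -(card_ord m) -(card_ord n) (bij_eq_card bf).
subst m; pose s := perm (bij_inj bf).
have -> : mxsub f f A = row_perm s (col_perm s A).
  by apply/matrixP => i j; rewrite !mxE !permE.
rewrite row_permE col_permE !det_mulmx !det_perm.
by rewrite mulrCA odd_permV -signr_addb addbb mulr1.
Qed.

(** Listing the indices of [S] first makes the matrix block triangular with an identity block. *)
Lemma det_identity_rows (n : nat) (M : 'M[K]_n) (S : {set 'I_n}) :
  \det (\matrix_(i, j) (if i \in S then M i j else (i == j)%:R))
  = \det (mxsub (@enum_val _ (mem S)) (@enum_val _ (mem S)) M).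
Proof.
pose S' := ~: S.
pose f (i : 'I_(#|S| + #|S'|)) : 'I_n :=
  match split i with inl a => enum_val a | inr b => enum_val b end.
have fl a : f (lshift _ a) = enum_val a by rewrite /f (unsplitK (inl a)).
have fr a : f (rshift _ a) = enum_val a by rewrite /f (unsplitK (inr a)).
have inS (a : 'I_#|S|) : enum_val a \in S by exact: enum_valP.
have inS' (a : 'I_#|S'|) : enum_val a \notin S by have := enum_valP a; rewrite inE.
have finj : injective f.
  move=> i j; rewrite -(splitK i) -(splitK j).
  case: (split i) => a; case: (split j) => b; rewrite /= ?fl ?fr.
  - by move=> /enum_val_inj ->.
  - by move=> h; have := inS' b; rewrite -h inS.
  - by move=> h; have := inS' a; rewrite h inS.
  - by move=> /enum_val_inj ->.
have bf : bijective f.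
  by apply: inj_card_bij => //; rewrite !card_ord /S' cardsC card_ord.
rewrite -(det_mxsub_bij _ bf).
set N := mxsub f f _.
have -> : N = block_mx (mxsub (@enum_val _ (mem S)) (@enum_val _ (mem S)) M)
    (\matrix_(i, j) M (f (lshift _ i)) (f (rshift _ j))) 0 1%:M.
  rewrite -[N]submxK; congr block_mx; apply/matrixP => i j; rewrite !mxE ?fl ?fr.
  - by rewrite inS.
  - by rewrite inS.
  - rewrite (negPf (inS' _)); case: eqP => // h.
    by have := inS' i; rewrite h inS.
  - by rewrite (negPf (inS' _)) (inj_eq enum_val_inj).
by rewrite det_ublock det1 mulr1.
Qed.

(** Multilinearity in the rows. General weights [c] are allowed because [c i = 0] forces i into S
    while [z i = 0] keeps it out, which cuts the sum down to an interval of sets. *)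
Lemma det_diag_expansion (n : nat) (c z : 'I_n -> K) (M : 'M[K]_n) :
  \det (\matrix_(i, j) (c i *+ (i == j) + z i * M i j))
  = \sum_(S : {set 'I_n}) (\prod_(i in S) z i) * (\prod_(i in ~: S) c i) *
      \det (mxsub (@enum_val _ (mem S)) (@enum_val _ (mem S)) M).
Proof.
rewrite [LHS]/determinant.
under eq_bigr => s _.
  under eq_bigr => i _ do rewrite mxE addrC.
  rewrite bigA_distr mulr_sumr.
  over.
rewrite exchange_big /=; apply: eq_bigr => S _.
rewrite -det_identity_rows [in RHS]/determinant mulr_sumr; apply: eq_bigr => s _.
rewrite mulrCA; congr (_ * _).
set N := \matrix_(i, j) _.
have NS : \prod_(i in S) N i (s i) = \prod_(i in S) M i (s i).
  by apply: eq_bigr => i iS; rewrite mxE iS.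
have NS' : \prod_(i | i \notin S) N i (s i) = \prod_(i | i \notin S) (i == s i)%:R.
  by apply: eq_bigr => i /negPf iS; rewrite mxE iS.
rewrite (bigID (fun i => i \in S)) /= [X in _ = _ * X](bigID (fun i => i \in S)) /= NS NS'.
have -> : \prod_(i in S) (if i \in S then z i * M i (s i) else c i *+ (i == s i))
    = \prod_(i in S) z i * \prod_(i in S) M i (s i).
  by rewrite -big_split; apply: eq_bigr => i ->.
have -> : \prod_(i | i \notin S) (if i \in S then z i * M i (s i) else c i *+ (i == s i))
    = \prod_(i in ~: S) c i * \prod_(i | i \notin S) (i == s i)%:R.
  rewrite [in RHS](eq_bigl (fun i => i \notin S)); last by move=> i; rewrite inE.
  by rewrite -big_split; apply: eq_bigr => i /negPf ->; rewrite /= mulr_natr.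
by ring.
Qed.
End DetExpansion.

Section SectorStability.
Variables (R : rcfType) (T : finType) (mu : {set T} -> R).
Local Notation C := R[i].
Local Notation toC := (real_complex R).

Implicit Types (U V S : {set T}) (z : T -> C).

Definition interval U V S := (U \subset S) && (S \subset V).

(** The generating polynomial contracted at [U] and restricted to [V], along the ray through [z]:
    its value at 1 is the multivariate polynomial at [z], and its coefficients are the homogeneous
    slices. *)
Definition gen_poly U V z : {poly C} :=
  \sum_(S | interval U V S)
    ((\prod_(i in S :\: U) z i) * (mu S)%:C%C) *: 'X^#|S :\: U|.

Hypothesis mu_gt0 : forall S, 0 < mu S.
Hypothesis gen_poly_neq0 : forall U V z,
  U \subset V -> (forall i, i \in V :\: U -> 0 <= Re (z i)) -> (gen_poly U V z).[1] != 0.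

Lemma horner_gen_poly U V z t :
  (gen_poly U V z).[t] = (gen_poly U V (fun i => t * z i)).[1].
Proof.
rewrite /gen_poly !horner_sum; apply: eq_bigr => S _.
rewrite !hornerZ !hornerXn expr1n mulr1 big_split /= prodr_const; ring.
Qed.

Lemma gen_poly_conj U V z :
  (gen_poly U V (fun i => (z i)^*%C)).[1] = ((gen_poly U V z).[1])^*%C.
Proof.
rewrite /gen_poly !horner_sum rmorph_sum; apply: eq_bigr => S _.
rewrite !hornerZ !hornerXn !expr1n !mulr1 rmorphM rmorph_prod /=.
by rewrite oppr0.
Qed.

Lemma coef_gen_poly U V z j : (gen_poly U V z)`_j =
  \sum_(S | interval U V S && (#|S :\: U| == j)) (\prod_(i in S :\: U) z i) * (mu S)%:C%C.
Proof.
rewrite /gen_poly coef_sum [RHS]big_mkcondr; apply: eq_bigr => S _.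
by rewrite coefZ coefXn eq_sym; case: eqP; rewrite ?mulr1 ?mulr0.
Qed.

Lemma size_coef_prod_affine (r : seq T) (a b : T -> C) :
  (size (\prod_(i <- r) ((a i)%:P + b i *: 'X))%R <= (size r).+1)%N
  /\ (\prod_(i <- r) ((a i)%:P + b i *: 'X))`_(size r) = \prod_(i <- r) b i.
Proof.
elim: r => [|i r [IHs IHc]]; first by rewrite !big_nil size_poly1 coefC.
rewrite !big_cons /= mulrDl -scalerAl mul_polyC; split.
  rewrite (leq_trans (size_polyD _ _)) // geq_max; apply/andP; split.
    by rewrite (leq_trans (size_scale_leq _ _)) // (leq_trans IHs).
  rewrite (leq_trans (size_scale_leq _ _)) // mulrC.
  by rewrite (leq_trans (size_polyMleq _ _)) // size_polyX addn2.
rewrite coefD !coefZ (nth_default _ IHs) mulr0 add0r mulrC [in LHS]mulrC.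
by rewrite coefXM /= IHc.
Qed.

(** Only the real parts of [z] are scaled, by a variable s: the half-plane Re s >= 0 keeps all
    coordinates in the right half-plane, s = 1 gives [z], and s = -1 gives the conjugate of [- z].
    As [mu] is real, [hurwitz_reflection] applied to this one-variable polynomial is the claim. *)
Lemma gen_poly_reflection U V z : U \proper V ->
  (forall i, i \in V :\: U -> 0 < Re (z i)) ->
  cn2 (gen_poly U V (fun i => - z i)).[1] < cn2 (gen_poly U V z).[1].
Proof.
move=> /properP[UV [i0 i0V i0U]] zpos.
pose phi : {poly C} := \sum_(S | interval U V S)
  (mu S)%:C%C *: \prod_(i in S :\: U) ((Complex 0 (Im (z i)))%:P + (Re (z i))%:C%C *: 'X).
have phiE s : phi.[s] = (gen_poly U V (fun i => (Complex 0 (Im (z i))) + (Re (z i))%:C%C * s)).[1].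
  rewrite /phi /gen_poly !horner_sum; apply: eq_bigr => S _.
  rewrite !hornerZ hornerXn expr1n mulr1 mulrC horner_prod; congr (_ * _).
  by apply: eq_bigr => i _; rewrite hornerD hornerC hornerZ hornerX.
have size_phi : (1 < size phi)%N.
  have : phi`_#|V :\: U| != 0.
    rewrite coef_sum (bigD1 V) /=; last by rewrite /interval UV subxx.
    rewrite [X in _ + X]big1 ?addr0.
      rewrite coefZ -big_enum /= cardE (size_coef_prod_affine _ _ _).2.
      apply: mulf_neq0; first by rewrite fmorph_eq0 gt_eqF.
      rewrite big_enum /=; apply/prodf_neq0 => i iVU.
      by rewrite fmorph_eq0 gt_eqF // zpos.
    move=> S /andP[/andP[US SV] SnV].
    rewrite coefZ nth_default ?mulr0 // -big_enum /=.
    rewrite (leq_trans (size_coef_prod_affine _ _ _).1) // -cardE proper_card //.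
    rewrite properE setSD //=; apply: contra SnV => VS.
    rewrite eqEsubset SV /=; apply/subsetP => i iV; have [iU|iU] := boolP (i \in U).
      exact: (subsetP US).
    by have /(subsetP VS) : i \in V :\: U; rewrite !inE ?iU // => /andP[].
  rewrite -(addn0 1%N) ltnNge; apply: contra => /leq_sizeP ->//.
  by rewrite card_gt0; apply/set0Pn; exists i0; rewrite inE i0U.
have phi_neq0 x : 0 <= Re x -> phi.[x] != 0.
  move=> hx; rewrite phiE gen_poly_neq0 // => i /zpos zi.
  by rewrite ReD ReM /= mul0r subr0 add0r mulr_ge0 // ltW.
have := hurwitz_reflection size_phi phi_neq0; rewrite !phiE.
have -> : (gen_poly U V (fun i => (Complex 0 (Im (z i))) + (Re (z i))%:C%C * 1)).[1]
   = (gen_poly U V z).[1].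
  congr (_.[1]); rewrite /gen_poly; apply: eq_bigr => S _; congr (_ * _ *: _).
  apply: eq_bigr => i _; rewrite mulr1; case: (z i) => u v;
  by apply/eqP; rewrite eq_complex /= addr0 add0r !eqxx.
have -> : (gen_poly U V (fun i => (Complex 0 (Im (z i))) + (Re (z i))%:C%C * -1)).[1]
   = ((gen_poly U V (fun i => - z i)).[1])^*%C.
  rewrite -gen_poly_conj; congr (_.[1]); rewrite /gen_poly; apply: eq_bigr => S _; congr (_ * _ *: _).
  apply: eq_bigr => i _; rewrite mulrN1; case: (z i) => u v;
  by apply/eqP; rewrite eq_complex /= oppr0 addr0 add0r opprK !eqxx.
by rewrite cn2_conj.
Qed.

(** The open sector |arg z| < pi/4. A nonzero point of the closed right half-plane has a square root
    in its closure, and that root times a point of the sector has positive real part. *)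
Definition sector (z : C) := (- Re z < Im z) && (Im z < Re z).

Lemma sector_Re (z : C) : sector z -> 0 < Re z.
Proof. by move=> /andP[h1 h2]; lra. Qed.

Lemma half_plane_sqrt (u : C) : 0 <= Re u -> u != 0 ->
  exists t : C, t ^+ 2 = u /\ - Re t <= Im t <= Re t.
Proof.
move=> hu u0; have [t tE] : exists t : C, t ^+ 2 = u by exists (sqrtc u); rewrite sqr_sqrtc.
have : Im t ^+ 2 <= Re t ^+ 2.
  by move: hu; rewrite -tE expr2 ReM !expr2 subr_ge0.
rewrite -(ler_sqrt _ (sqr_ge0 _)) !sqrtr_sqr => hle.
case: (lerP 0 (Re t)) => ht.
  exists t; split=> //; move: hle; rewrite (ger0_norm ht) ler_norml //.
exists (- t); split; first by rewrite sqrrN.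
move: hle; rewrite (ltr0_norm ht) ler_norml opprK ReN ImN; lra.
Qed.

Lemma Re_mul_sector (t z : C) : t != 0 -> - Re t <= Im t <= Re t -> sector z ->
  0 < Re (t * z).
Proof.
move=> t0 /andP[h1 h2] /andP[h3 h4]; rewrite ReM.
have : 0 < Re t.
  rewrite lt_neqAle; apply/andP; split; last by lra.
  apply: contraNneq t0 => ht; rewrite eq_complex /= -ht eqxx /=; apply/eqP; lra.
case: t h1 h2 {t0} => a b /=; case: z h3 h4 => x y /= h3 h4 h1 h2 a0.
have [hb|hb] : 0 < a - b \/ 0 < a + b by have [h|h] := ltrP b a; [left|right]; lra.
  nra.
nra.
Qed.

(* With [u = t^2], a zero of the even or odd part makes [f (t z)] and [f (- t z)]
   equal up to sign, against [gen_poly_reflection]. *)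
Lemma even_odd_part_neq0 U V z u : U \proper V ->
  (forall i, i \in V :\: U -> sector (z i)) -> 0 <= Re u -> u != 0 ->
  (even_poly (gen_poly U V z)).[u] != 0 /\ (odd_poly (gen_poly U V z)).[u] != 0.
Proof.
move=> UV zsec hu u0; have [t [tE ht]] := half_plane_sqrt hu u0.
have t0 : t != 0 by apply: contraNneq u0 => t0; rewrite -tE t0 expr0n.
set P := gen_poly U V z.
have tz i : i \in V :\: U -> 0 < Re (t * z i) by move=> /zsec; exact: Re_mul_sector.
have := gen_poly_reflection UV tz.
have -> : (gen_poly U V (fun i => - (t * z i))).[1] = P.[- t].
  rewrite [RHS]horner_gen_poly; congr (_.[1]); rewrite /gen_poly.
  apply: eq_bigr => S _; congr (_ * _ *: _).
  by apply: eq_bigr => i _; rewrite mulNr.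
rewrite -horner_gen_poly -/P => hlt.
have Pt v : P.[v] = (even_poly P).[v ^+ 2] + (odd_poly P).[v ^+ 2] * v.
  by rewrite -{1}(poly_even_odd P) hornerD hornerMX !horner_comp !hornerXn.
move: hlt; rewrite !Pt sqrrN tE mulrN => hlt.
split; apply: contraTneq hlt => ->; rewrite -leNgt.
  by rewrite !add0r cn2N.
by rewrite !mul0r oppr0.
Qed.

(** The even and odd parts have no root in the closed right half-plane, so all their coefficients up
    to the degree are nonzero. The coefficients 0 and 1 are treated apart to exclude the root 0, and
    the coefficients [m] and [m.-1] to know that the degrees are as large as possible. *)
Lemma sector_coef_neq0 U V z j : U \subset V ->
  (forall i, i \in V :\: U -> sector (z i)) -> (j <= #|V :\: U|)%N ->
  (gen_poly U V z)`_j != 0.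
Proof.
move=> UV zsec hj; set P := gen_poly U V z; set m := #|V :\: U| in hj.
have [UeqV|UnV] := eqVneq U V.
  have m0 : m = 0%N by rewrite /m UeqV setDv cards0.
  have -> : j = 0%N by lia.
  by rewrite -horner_coef0 /P horner_gen_poly gen_poly_neq0 // => i _; rewrite mul0r.
have UpV : U \proper V by rewrite properEneq UnV.
have m0 : (0 < m)%N.
  by have /properP[_ [i iV iU]] := UpV; rewrite card_gt0; apply/set0Pn; exists i; rewrite inE iU.
have zre i : i \in V :\: U -> 0 < Re (z i) by move=> /zsec /sector_Re.
have P0 : P`_0 != 0.
  by rewrite -horner_coef0 /P horner_gen_poly gen_poly_neq0 // => i _; rewrite mul0r.
have P1 : P`_1 != 0.
  apply: Re_neq0; rewrite coef_gen_poly Re_sum.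
  have term S : interval U V S && (#|S :\: U| == 1%N) ->
      0 < Re ((\prod_(i in S :\: U) z i) * (mu S)%:C%C).
    move=> /andP[/andP[US SV] /cards1P[i SUi]]; rewrite SUi big_set1 ReM /= mulr0 subr0.
    rewrite mulr_gt0 // zre // inE; have : i \in S :\: U by rewrite SUi set11.
    by rewrite inE => /andP[-> iS]; rewrite (subsetP SV).
  have /properP[_ [i iV iU]] := UpV.
  have Si : interval U V (i |: U) && (#|(i |: U) :\: U| == 1%N).
    rewrite /interval subsetUr subUset sub1set iV UV /=.
    by rewrite setDUl setDv setU0; apply/cards1P; exists i; apply/setDidPl; rewrite disjoints1.
  rewrite (bigD1 (i |: U) Si) /= ltr_pwDl ?term // sumr_ge0 // => S /andP[/term/ltW].
  by [].
have Pm : P`_m != 0.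
  rewrite coef_gen_poly (bigD1 V) /=; last by rewrite /interval UV subxx eqxx.
  rewrite [X in _ + X]big1 ?addr0.
    apply: mulf_neq0; last by rewrite fmorph_eq0 gt_eqF.
    apply/prodf_neq0 => i /zre.
    by apply: contraTneq => ->; rewrite ltxx.
  move=> S /andP[/andP[/andP[US SV] /eqP SUm] /negP[]].
  rewrite eqEcard SV /=.
  by rewrite -(cardsID U V) -(cardsID U S) (setIidPr UV) (setIidPr US) SUm.
(* Dividing by the full product [Z] leaves a positive combination of inverses of single [z i], all
   of positive real part. *)
have Pm1 : P`_m.-1 != 0.
  rewrite coef_gen_poly.
  set Z := \prod_(i in V :\: U) z i.
  have Z0 : Z != 0.
    by apply/prodf_neq0 => i /zre; apply: contraTneq => ->; rewrite ltxx.
  have ZE S : interval U V S -> \prod_(i in S :\: U) z i = Z * (\prod_(i in V :\: S) z i)^-1.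
    move=> /andP[US SV]; rewrite /Z [X in _ = X / _](big_setID S) /=.
    have -> : (V :\: U) :&: S = S :\: U by rewrite setIDAC (setIidPr SV).
    have -> : (V :\: U) :\: S = V :\: S by rewrite setDDl (setUidPr US).
    rewrite mulfK //; apply/prodf_neq0 => i; rewrite inE => /andP[iS iV].
    have /zre : i \in V :\: U by rewrite inE iV andbT; apply: contra iS; apply: (subsetP US).
    by apply: contraTneq => ->; rewrite ltxx.
  under eq_bigr => S /andP[/ZE -> _] do rewrite -mulrA.
  rewrite -mulr_sumr mulf_neq0 //; apply: Re_neq0; rewrite Re_sum.
  have term S : interval U V S && (#|S :\: U| == m.-1) ->
      0 < Re ((\prod_(i in V :\: S) z i)^-1 * (mu S)%:C%C).
    move=> /andP[/andP[US SV] /eqP SUm].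
    have : #|V :\: S| == 1%N.
      have := cardsID S (V :\: U); rewrite setIDAC (setIidPr SV) setDDl (setUidPr US) SUm -/m.
      by move=> h; apply/eqP; lia.
    move=> /cards1P[i VSi]; rewrite VSi big_set1 ReM /= mulr0 subr0.
    rewrite mulr_gt0 // Re_inv_gt0 // zre // inE; have : i \in V :\: S by rewrite VSi set11.
    by rewrite inE => /andP[iS ->]; rewrite andbT; apply: contra iS; apply: (subsetP US).
  have /properP[_ [i iV iU]] := UpV.
  have Si : interval U V (V :\ i) && (#|(V :\ i) :\: U| == m.-1).
    rewrite /interval subD1set subsetD1 UV iU /= setDDl setUC -setDDl.
    by rewrite /m (cardsD1 i (V :\: U)) !inE iV iU.
  rewrite (bigD1 (V :\ i) Si) /= ltr_pwDl ?term // sumr_ge0 // => S /andP[/term/ltW].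
  by [].
have evenN u : 0 <= Re u -> (even_poly P).[u] != 0.
  have [->|u0] := eqVneq u 0 => hu; last by have [] := even_odd_part_neq0 UpV zsec hu u0.
  by rewrite horner_coef0 coef_even_poly.
have oddN u : 0 <= Re u -> (odd_poly P).[u] != 0.
  have [->|u0] := eqVneq u 0 => hu; last by have [] := even_odd_part_neq0 UpV zsec hu u0.
  by rewrite horner_coef0 coef_odd_poly.
have sz (p : {poly C}) i k : (i <= k)%N -> p`_k != 0 -> (i < size p)%N.
  move=> ik; apply: contraR; rewrite -leqNgt => sp.
  by rewrite nth_default // (leq_trans sp).
have [jo|je] := boolP (odd j).
  have -> : P`_j = (odd_poly P)`_(j./2).
    by rewrite coef_odd_poly -[in LHS](odd_double_half j) jo add1n.
  apply: half_plane_coef_neq0 => //.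
  have [mo|me] := boolP (odd m).
    apply: (@sz _ _ m./2); first by rewrite half_leq.
    by rewrite coef_odd_poly; move: Pm; rewrite -{1}(odd_double_half m) mo add1n.
  apply: (@sz _ _ m.-1./2); first by rewrite half_leq //; move: jo me; lia.
  have mo : odd m.-1 by move: me m0; lia.
  by rewrite coef_odd_poly; move: Pm1; rewrite -{1}(odd_double_half m.-1) mo add1n.
have -> : P`_j = (even_poly P)`_(j./2).
  by rewrite coef_even_poly -[in LHS](odd_double_half j) (negPf je) add0n.
apply: half_plane_coef_neq0 => //.
have [mo|me] := boolP (odd m).
  apply: (@sz _ _ m.-1./2); first by rewrite half_leq //; move: je mo; lia.
  have me : odd m.-1 = false by move: mo; lia.
  by rewrite coef_even_poly; move: Pm1; rewrite -{1}(odd_double_half m.-1) me add0n.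
apply: (@sz _ _ m./2); first by rewrite half_leq.
by rewrite coef_even_poly; move: Pm; rewrite -{1}(odd_double_half m) (negPf me) add0n.
Qed.

(* With [x = s^2], weight [s w] on [A] and [w / s] off [A] lies in the sector. *)
Lemma slice_hurwitz U V (w : T -> R) (A : {set T}) j (x : C) : U \subset V ->
  (forall i, 0 < w i) -> (j <= #|V :\: U|)%N -> 0 < Re x ->
  \sum_(S | interval U V S && (#|S :\: U| == j))
    (\prod_(i in S :\: U) (w i)%:C%C) * (mu S)%:C%C * x ^+ #|(S :\: U) :&: A| != 0.
Proof.
move=> UV w0 hj hx.
have x0 : x != 0 by apply: Re_neq0.
have [s [sE hs]] := half_plane_sqrt (ltW hx) x0.
have s0 : s != 0 by apply: contraNneq x0 => s0; rewrite -sE s0 expr0n.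
have ssec : sector s.
  move: hs => /andP[h1 h2]; move: hx; rewrite -sE expr2 ReM; case: s h1 h2 {sE s0} => a b /= h1 h2 h.
  by rewrite /sector /=; apply/andP; split; nra.
have sVsec : sector s^-1.
  have n0 : 0 < (cn2 s)^-1 by rewrite invr_gt0 cn2_gt0.
  move: ssec n0; rewrite /sector Re_inv -/(cn2 s).
  have -> : Im s^-1 = - Im s / cn2 s by case: (s) => u v; rewrite /= mulNr.
  move=> /andP[h1 h2] n0; by apply/andP; split; nra.
pose z i := (w i)%:C%C * (if i \in A then s else s^-1).
have zsec i : i \in V :\: U -> sector (z i).
  move=> _; have := w0 i; rewrite /z /sector ReM ImM /= !mul0r subr0 addr0.
  case: ifP => _ wi; [move: ssec|move: sVsec]; move=> /andP[h1 h2]; apply/andP; split; nra.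
have := sector_coef_neq0 UV zsec hj; apply: contraNneq => h0.
suff -> : (gen_poly U V z)`_j = 0 by [].
apply: (mulIf (expf_neq0 j s0)); rewrite mul0r -[RHS]h0 coef_gen_poly mulr_suml.
apply: eq_bigr => S /andP[_ /eqP <-].
rewrite mulrAC [RHS]mulrAC; congr (_ * _).
rewrite /z big_split /= -mulrA; congr (_ * _).
have -> : \prod_(i in S :\: U) (if i \in A then s else s^-1)
   = s ^+ #|(S :\: U) :&: A| * s ^- #|(S :\: U) :\: A|.
  rewrite (big_setID A) /= (eq_bigr (fun=> s)) ?prodr_const; last first.
    by move=> i; rewrite inE => /andP[_ ->].
  rewrite (eq_bigr (fun=> s^-1)) ?prodr_const ?exprVn //.
  by move=> i; rewrite inE => /andP[/negPf -> _].
rewrite -[in s ^+ #|S :\: U|](cardsID A (S :\: U)) exprD mulrACA.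
by rewrite mulVf ?expf_neq0 // mulr1 -sE -exprM mul2n -addnn exprD.
Qed.
End SectorStability.

(** * Half-plane stability and positivity of minors for positive definite forms *)

Section PositiveDefinite.
Variables (R : realType) (n : nat) (L : 'M[R]_n).
Local Notation C := R[i].
Local Notation toC := (real_complex R).

Hypothesis L_pd : forall x : 'I_n -> R, (exists i, x i != 0) ->
  0 < \sum_i x i * \sum_j L i j * x j.

(** For a kernel vector v and y = L v, the rows say y_i = 0 on [U], v_i = - z_i y_i on [V :\: U] and
    v_i = 0 outside [V]. Hence the form of [L] at Re v plus that at Im v equals minus the sum of Re
    z_i |y_i|^2, which contradicts positivity. *)
Lemma pd_det_neq0 (U V : {set 'I_n}) (z : 'I_n -> C) :
  (forall i, i \in V :\: U -> 0 <= Re (z i)) ->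
  \det (\matrix_(i, j) ((i \notin U)%:R *+ (i == j) +
      (if i \in U then 1 else if i \in V then z i else 0) * (L i j)%:C%C)) != 0.
Proof.
move=> hz; set M := \matrix_(i, j) _.
rewrite -det_tr; apply/negP => /det0P[v v0 vM].
pose y i := \sum_j (L i j)%:C%C * v 0 j.
have row_eq i : (i \notin U)%:R * v 0 i +
    (if i \in U then 1 else if i \in V then z i else 0) * y i = 0.
  have := congr1 (fun u : 'rV_n => u 0 i) vM; rewrite !mxE => hsum.
  rewrite -[RHS]hsum /y mulr_sumr.
  under [RHS]eq_bigr => j _ do rewrite !mxE mulrDr mulrnAr mulrC.
  rewrite big_split /=; congr (_ + _); last by apply: eq_bigr => j _; ring.
  rewrite (bigD1 i) //= eqxx mulr1n mulrC big1 ?addr0 // => j /negPf ji.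
  by rewrite eq_sym ji mulr0n.
have Rey i : Re (y i) = \sum_j L i j * Re (v 0 j).
  by rewrite /y Re_sum; apply: eq_bigr => j _; rewrite ReM /= mul0r subr0.
have Imy i : Im (y i) = \sum_j L i j * Im (v 0 j).
  rewrite /y; elim/big_rec2: _ => // j a b _ <-.
  by rewrite ImD ImM /= mul0r addr0.
pose qr := \sum_i Re (v 0 i) * \sum_j L i j * Re (v 0 j).
pose qi := \sum_i Im (v 0 i) * \sum_j L i j * Im (v 0 j).
have q_ge0 (x : 'I_n -> R) : 0 <= \sum_i x i * \sum_j L i j * x j.
  have [/existsP ex|] := boolP [exists i, x i != 0]; first exact/ltW/L_pd.
  rewrite negb_exists => /forallP x0; rewrite big1 // => i _.
  by have := x0 i; rewrite negbK => /eqP ->; rewrite mul0r.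
have q_gt0 : 0 < qr + qi.
  have [i vi] : exists i, v 0 i != 0.
    apply/existsP; apply: contraNT v0; rewrite negb_exists => /forallP vz.
    by apply/eqP/rowP => i; rewrite mxE; apply/eqP; have := vz i; rewrite negbK.
  have [rv|rv] := eqVneq (Re (v 0 i)) 0.
    rewrite ltr_wpDl ?q_ge0 // L_pd //; exists i.
    by apply: contraNneq vi => iv; rewrite eq_complex rv iv !eqxx.
  by rewrite ltr_pwDl ?q_ge0 // L_pd //; exists i.
have : qr + qi <= 0.
  rewrite /qr /qi -big_split /= -oppr_ge0 -sumrN sumr_ge0 // => i _.
  rewrite -Rey -Imy; move: (row_eq i) (hz i); rewrite !inE.
  case: (i \in U) => /=.
    by rewrite mul0r add0r mul1r => -> _ /=; rewrite !mulr0 addr0 oppr0.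
  rewrite mul1r => /eqP; rewrite addr_eq0 => /eqP ->.
  case: (i \in V) => [/(_ isT) zi|_]; last by rewrite mul0r oppr0 /= !mul0r addr0 oppr0.
  rewrite ReN ImN ReM ImM.
  have -> : - (- (Re (z i) * Re (y i) - Im (z i) * Im (y i)) * Re (y i) +
     - (Re (z i) * Im (y i) + Im (z i) * Re (y i)) * Im (y i))
     = Re (z i) * cn2 (y i) by rewrite /cn2; ring.
  by rewrite mulr_ge0 ?cn2_ge0.
by rewrite leNgt q_gt0.
Qed.

Lemma pd_gen_poly_neq0 (U V : {set 'I_n}) (z : 'I_n -> C) : U \subset V ->
  (forall i, i \in V :\: U -> 0 <= Re (z i)) ->
  (gen_poly (principal_minor L) U V z).[1] != 0.
Proof.
move=> UV hz; have := pd_det_neq0 hz.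
have -> : (\matrix_(i, j) ((i \notin U)%:R *+ (i == j) +
      (if i \in U then 1 else if i \in V then z i else 0) * (L i j)%:C%C))
  = \matrix_(i, j) ((i \notin U)%:R *+ (i == j) +
      (if i \in U then 1 else if i \in V then z i else 0) * (map_mx toC L) i j).
  by apply/matrixP => i j; rewrite !mxE.
rewrite (det_diag_expansion (fun i => (i \notin U)%:R)
  (fun i => if i \in U then 1 else if i \in V then z i else 0)).
apply: contraNneq => h0; apply/eqP; rewrite -[RHS]h0 /gen_poly horner_sum [RHS]big_mkcond /=.
apply: eq_bigr => S _; rewrite hornerZ hornerXn expr1n mulr1.
have -> : \det (mxsub (@enum_val _ (mem S)) (@enum_val _ (mem S)) (map_mx toC L))
   = (principal_minor L S)%:C%C.
  by rewrite /principal_minor /principal_submx -det_map_mx map_mxsub.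
case: ifP => [/andP[US SV]|hUV].
  congr (_ * _).
  rewrite [X in _ * X]big1 ?mulr1; last first.
    move=> i; rewrite inE => iS; case: (boolP (i \in U)) => // iU.
    by rewrite (subsetP US) in iS.
  rewrite (big_setID U) /= big1 ?mul1r; last by move=> i; rewrite inE => /andP[_ ->].
  by apply: eq_bigr => i; rewrite inE => /andP[/negPf -> iS]; rewrite (subsetP SV).
move: hUV => /negbT; rewrite negb_and => /orP[/subsetPn[i iU iS]|/subsetPn[i iS iV]].
  by rewrite [X in _ * X * _](bigD1 i) ?inE //= iU mul0r mulr0 mul0r.
rewrite (bigD1 i) //= (negPf iV).
case: ifP => iU; last by rewrite !mul0r.
by rewrite (subsetP UV) in iV.
Qed.

Lemma principal_minor0 : principal_minor L set0 = 1.
Proof.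
rewrite /principal_minor; move: (principal_submx L set0).
by rewrite cards0 => A; rewrite det_mx00.
Qed.

(** Along the segment (1 - t) I + t L the minor starts at 1 and never vanishes, by stability with
    all variables equal to t / (1 - t); the intermediate value theorem gives its sign at t = 1. *)
Lemma pd_principal_minor_gt0 (S : {set 'I_n}) : 0 < principal_minor L S.
Proof.
have nz (s : R) : 0 <= s ->
    \sum_(S' : {set 'I_n} | S' \subset S) s ^+ #|S'| * principal_minor L S' != 0.
  move=> s0.
  have := @pd_gen_poly_neq0 set0 S (fun=> s%:C%C) (sub0set _) (fun _ _ => s0).
  apply: contraNneq => h; apply/eqP; rewrite /gen_poly horner_sum -(rmorph0 toC) -[in RHS]h rmorph_sum.
  apply: eq_big => [S'|S' _]; first by rewrite /interval sub0set.
  by rewrite hornerZ hornerXn expr1n mulr1 setD0 prodr_const rmorphM rmorphXn.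
pose p : {poly R} := \sum_(S' : {set 'I_n} | S' \subset S)
   principal_minor L S' *: ((1 - 'X) ^+ #|S :\: S'| * 'X ^+ #|S'|).
have pE t : p.[t] = \sum_(S' : {set 'I_n} | S' \subset S)
   principal_minor L S' * ((1 - t) ^+ #|S :\: S'| * t ^+ #|S'|).
  rewrite /p horner_sum; apply: eq_bigr => S' _.
  by rewrite hornerZ hornerM !horner_exp hornerD hornerN hornerX hornerC.
have p0 : p.[0] = 1.
  rewrite pE (bigD1 set0) ?sub0set //= big1 ?addr0 => [|S' /andP[_ S'0]].
    by rewrite principal_minor0 cards0 subr0 expr1n !mulr1.
  by rewrite [0 ^+ _]expr0n cards_eq0 (negPf S'0) !mulr0.
have p1 : p.[1] = principal_minor L S.
  rewrite pE (bigD1 S) ?subxx //= big1 ?addr0 => [|S' /andP[S'S S'nS]].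
    by rewrite setDv cards0 expr1n !mulr1.
  rewrite subrr expr0n cards_eq0 setD_eq0.
  have -> : (S \subset S') = false.
    by apply: contraNF S'nS => SS'; rewrite eqEsubset S'S.
  by rewrite mul0r mulr0.
have pnz t : 0 <= t <= 1 -> p.[t] != 0.
  move=> /andP[t0 t1]; have [tE|tn] := eqVneq t 1.
    rewrite tE p1.
    have := @pd_gen_poly_neq0 S S (fun=> 0) (subxx _).
    rewrite /gen_poly (big_pred1 S); last by move=> S' /=; rewrite /interval eqEsubset andbC.
    rewrite hornerZ hornerXn expr1n mulr1 setDv big_set0 mul1r.
    rewrite fmorph_eq0; apply=> i; by rewrite inE.
  have t1' : 0 < 1 - t by rewrite subr_gt0 lt_neqAle tn.
  have := nz (t / (1 - t)) (divr_ge0 t0 (ltW t1')).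
  apply: contraNneq => h; apply/eqP.
  apply: (mulfI (expf_neq0 #|S| (lt0r_neq0 t1'))); rewrite mulr0 -[RHS]h pE mulr_sumr.
  apply: eq_bigr => S' S'S; rewrite -(cardsID S' S) (setIidPr S'S) exprD expr_div_n.
  by field; rewrite expf_neq0 // lt0r_neq0.
rewrite -p1 ltNge; apply/negP => p1le.
have [t] : {t | t \in `[0, 1] & root p t}.
  by apply: polyrcf.poly_ivt; rewrite ?ler01 // p0 mul1r.
by rewrite in_itv /= => /pnz pt /eqP; apply/eqP.
Qed.
End PositiveDefinite.

(** * Cheeger's inequality *)

Section Cheeger.
Variables (R : realFieldType) (T : finType) (w : T -> T -> R) (phi : R).
Implicit Types (A : {set T}) (f x y : T -> R).

Let deg a : R := \sum_b w a b.
Let tot : R := \sum_a deg a.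

Hypothesis w_ge0 : forall a b, 0 <= w a b.
Hypothesis w_sym : forall a b, w a b = w b a.
Hypothesis phi_gt0 : 0 < phi.
Hypothesis cut_ge : forall A, 2 * \sum_(a in A) deg a <= tot ->
  phi * \sum_(a in A) deg a <= \sum_(a in A) \sum_(b | b \notin A) w a b.

Lemma deg_ge0 a : 0 <= deg a.
Proof. exact: sumr_ge0. Qed.

(** The coarea formula by peeling: with [c] the least nonzero value of [f] and [A] its support, [f]
    is [c] times the indicator of [A] plus some [g] of smaller support. Both sides are additive
    under this splitting, and the indicator is the cut hypothesis. *)
Lemma cheeger_coarea f : (forall a, 0 <= f a) ->
  2 * \sum_(a | f a != 0) deg a <= tot ->
  2 * phi * \sum_a deg a * f a <= \sum_a \sum_b w a b * `|f a - f b|.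
Proof.
have [n] := ubnP #|[set a | f a != 0]|; elim: n f => // n IH f.
rewrite ltnS => cardf f0 fhalf; set A := [set a | f a != 0] in cardf.
have [A0|/set0Pn[a0 a0A]] := eqVneq A set0.
  have fz a : f a = 0.
    by apply/eqP; have := in_set0 a; rewrite -A0 inE => /negbFE.
  rewrite [in leLHS]big1 ?mulr0 => [|a _]; last by rewrite fz mulr0.
  by apply: sumr_ge0 => a _; apply: sumr_ge0 => b _; rewrite mulr_ge0.
case: (@arg_minP _ _ _ a0 (fun a => a \in A) f a0A) => a1 a1A a1min.
set c := f a1 in a1min.
have c0 : 0 < c by rewrite lt_neqAle f0 andbT eq_sym; move: a1A; rewrite inE.
pose g a := if a \in A then f a - c else 0.
have g0 a : 0 <= g a.
  by rewrite /g; case: ifP => // /a1min; rewrite subr_ge0.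
have gA : [set a | g a != 0] \subset A :\ a1.
  apply/subsetP => a; rewrite !inE /g; case: ifP => [|_]; last by rewrite eqxx.
  rewrite inE => -> ga; rewrite andbT; apply: contraNneq ga => ->.
  by rewrite subrr.
have degA : \sum_(a in A) deg a = \sum_(a | f a != 0) deg a.
  by apply: eq_bigl => a; rewrite inE.
have gle : \sum_(a | g a != 0) deg a <= \sum_(a | f a != 0) deg a.
  rewrite -degA [leRHS](bigID (fun a => g a != 0)) /=.
  rewrite (eq_bigl (fun a => (a \in A) && (g a != 0))).
    by rewrite lerDl sumr_ge0 // => a _; exact: deg_ge0.
  move=> a; case: (boolP (g a != 0)) => [ga|_]; rewrite ?andbF // andbT.
  have ag : a \in [set a | g a != 0] by rewrite inE.
  by have := subsetP gA _ ag; rewrite inE => /andP[_ ->].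
have IHg := IH g _ g0 _.
have {IHg} IHg : 2 * phi * \sum_a deg a * g a <= \sum_a \sum_b w a b * `|g a - g b|.
  apply: IHg; last by apply: le_trans fhalf; rewrite ler_pM2l.
  apply: leq_trans cardf; apply: leq_ltn_trans (subset_leq_card gA) _.
  by rewrite [X in (_ < X)%N](cardsD1 a1) a1A.
pose h a : R := (a \in A)%:R.
have fE a : f a = c * h a + g a.
  rewrite /h /g; case: ifP => aA; first by rewrite mulr1 addrC subrK.
  by rewrite mulr0 addr0; apply/eqP; move: aA; rewrite inE => /negbFE.
have absE a b : `|f a - f b| = c * `|h a - h b| + `|g a - g b|.
  rewrite /h /g; case: ifP => aA; case: ifP => bA.
  - by rewrite subrr normr0 mulr0 add0r opprB addrA subrK.
  - have -> : f b = 0 by apply/eqP; move: bA; rewrite inE => /negbFE.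
    rewrite !subr0 normr1 mulr1 !ger0_norm ?subr_ge0 ?a1min //.
    by rewrite addrC subrK.
  - have -> : f a = 0 by apply/eqP; move: aA; rewrite inE => /negbFE.
    rewrite !sub0r !normrN normr1 mulr1 !ger0_norm ?subr_ge0 ?a1min //.
    by rewrite addrC subrK.
  - have -> : f a = 0 by apply/eqP; move: aA; rewrite inE => /negbFE.
    have -> : f b = 0 by apply/eqP; move: bA; rewrite inE => /negbFE.
    by rewrite !subrr normr0 mulr0 addr0.
have cutE : \sum_a \sum_b w a b * `|h a - h b|
    = 2 * \sum_(a in A) \sum_(b | b \notin A) w a b.
  have e1 : \sum_a \sum_b w a b * (h a * (1 - h b))
      = \sum_(a in A) \sum_(b | b \notin A) w a b.
    rewrite [RHS]big_mkcond; apply: eq_bigr => a _; rewrite /h.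
    case: ifP => aA; last by rewrite big1 // => b _; rewrite mul0r mulr0.
    rewrite [RHS]big_mkcond; apply: eq_bigr => b _.
    by case: (b \in A); rewrite /= mul1r ?subrr ?subr0 ?mulr0 ?mulr1.
  have e2 : \sum_a \sum_b w a b * (h b * (1 - h a))
      = \sum_(a in A) \sum_(b | b \notin A) w a b.
    rewrite -e1 exchange_big /=; apply: eq_bigr => a _; apply: eq_bigr => b _.
    by rewrite w_sym.
  rewrite mulr2n mulrDl !mul1r -{1}e1 -e2 -big_split /=; apply: eq_bigr => a _.
  rewrite -big_split /=; apply: eq_bigr => b _; rewrite -mulrDr; congr (_ * _).
  rewrite /h; case: (a \in A); case: (b \in A) => /=.
  - by rewrite !subrr normr0 mulr0 addr0.
  - by rewrite !subr0 subrr normr1 mulr1 mulr0 addr0.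
  - by rewrite sub0r normrN normr1 subr0 subrr mulr0 mulr1 add0r.
  - by rewrite subrr normr0 !mul0r addr0.
have hcut : phi * \sum_a deg a * h a <= \sum_(a in A) \sum_(b | b \notin A) w a b.
  have -> : \sum_a deg a * h a = \sum_(a in A) deg a.
    rewrite [RHS]big_mkcond; apply: eq_bigr => a _; rewrite /h.
    by case: (a \in A); rewrite ?mulr1 ?mulr0.
  by apply: cut_ge; rewrite degA.
have -> : \sum_a deg a * f a = c * \sum_a deg a * h a + \sum_a deg a * g a.
  rewrite mulr_sumr -big_split /=; apply: eq_bigr => a _; rewrite fE; ring.
have -> : \sum_a \sum_b w a b * `|f a - f b|
   = c * \sum_a \sum_b w a b * `|h a - h b| + \sum_a \sum_b w a b * `|g a - g b|.
  rewrite mulr_sumr -big_split /=; apply: eq_bigr => a _.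
  rewrite mulr_sumr -big_split /=; apply: eq_bigr => b _; rewrite absE; ring.
rewrite cutE.
have := ler_wpM2l (ltW c0) hcut.
by move: IHg; lra.
Qed.

(** The coarea inequality for the squares of [y]. A pointwise AM-GM weighted by [phi] takes the
    place of Cauchy-Schwarz and avoids square roots. *)
Lemma cheeger_nonneg y : (forall a, 0 <= y a) ->
  2 * \sum_(a | y a != 0) deg a <= tot ->
  phi ^+ 2 * \sum_a deg a * y a ^+ 2 <= \sum_a \sum_b w a b * (y a - y b) ^+ 2.
Proof.
move=> y0 yhalf; set N := \sum_a deg a * y a ^+ 2; set D := \sum_a \sum_b _.
have h1 : 2 * phi * N <= \sum_a \sum_b w a b * `|y a ^+ 2 - y b ^+ 2|.
  apply: cheeger_coarea => [a|]; first exact: sqr_ge0.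
  by rewrite (eq_bigl (fun a => y a != 0)) // => a; rewrite sqrf_eq0.
have NE : \sum_a \sum_b w a b * (y a ^+ 2 + y b ^+ 2) = 2 * N.
  have e1 : \sum_a \sum_b w a b * y a ^+ 2 = N.
    by apply: eq_bigr => a _; rewrite -mulr_suml.
  have e2 : \sum_a \sum_b w a b * y b ^+ 2 = N.
    by rewrite -e1 exchange_big /=; apply: eq_bigr => a _; apply: eq_bigr => b _; rewrite w_sym.
  rewrite mulr2n mulrDl !mul1r -{1}e1 -e2 -big_split /=; apply: eq_bigr => a _.
  by rewrite -big_split /=; apply: eq_bigr => b _; rewrite mulrDr.
have h2 : phi * \sum_a \sum_b w a b * `|y a ^+ 2 - y b ^+ 2|
    <= D + phi ^+ 2 * N.
  have -> : phi ^+ 2 * N = phi ^+ 2 / 2 * \sum_a \sum_b w a b * (y a ^+ 2 + y b ^+ 2).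
    by rewrite NE; field.
  rewrite mulr_sumr [X in _ <= _ + X]mulr_sumr -big_split /=; apply: ler_sum => a _.
  rewrite mulr_sumr [X in _ <= _ + X]mulr_sumr -big_split /=; apply: ler_sum => b _.
  have -> : phi * (w a b * `|y a ^+ 2 - y b ^+ 2|) = w a b * (phi * `|y a ^+ 2 - y b ^+ 2|) by ring.
  have -> : w a b * (y a - y b) ^+ 2 + phi ^+ 2 / 2 * (w a b * (y a ^+ 2 + y b ^+ 2))
     = w a b * ((y a - y b) ^+ 2 + phi ^+ 2 / 2 * (y a ^+ 2 + y b ^+ 2)) by ring.
  rewrite ler_wpM2l // subr_sqr normrM [`|y a + y b|]ger0_norm ?addr_ge0 //.
  rewrite -[in leRHS]real_normK ?num_real //; set t := `|_|.
  (* AM-GM: [2 t (phi s / 2) <= t^2 + (phi s / 2)^2] and [s^2 <= 2 (y a^2 + y b^2)] *)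
  have := sqr_ge0 (t - phi / 2 * (y a + y b)).
  have := mulr_ge0 (sqr_ge0 phi) (sqr_ge0 (y a - y b)).
  by nra.
have : phi * (2 * phi * N) <= D + phi ^+ 2 * N.
  by apply: le_trans h2; rewrite ler_pM2l.
have -> : phi * (2 * phi * N) = 2 * (phi ^+ 2 * N) by ring.
by lra.
Qed.

Lemma exists_median x : (0 < #|T|)%N -> exists c,
  2 * \sum_(a | c < x a) deg a <= tot /\ 2 * \sum_(a | x a < c) deg a <= tot.
Proof.
move=> /card_gt0P[a0 _].
pose P a := tot <= 2 * \sum_(b | x b <= x a) deg b.
have tot0 : 0 <= tot by apply: sumr_ge0 => a _; exact: deg_ge0.
case: (@arg_maxP _ _ _ a0 predT x isT) => a1 _ a1max.
have Pa1 : P a1.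
  rewrite /P (eq_bigl predT); last by move=> b; rewrite /= [_ <= _](a1max b isT).
  by rewrite -/tot; lra.
case: (@arg_minP _ _ _ a1 P x Pa1) => a2 Pa2 a2min.
exists (x a2); split.
  have : tot = \sum_(b | x b <= x a2) deg b + \sum_(b | x a2 < x b) deg b.
    rewrite /tot (bigID (fun b => x b <= x a2)) /=; congr (_ + _).
    by apply: eq_bigl => b; rewrite -ltNge.
  by move: Pa2; rewrite /P; lra.
have [/existsP[b0 hb0]|] := boolP [exists b, x b < x a2]; last first.
  rewrite negb_exists => /forallP h; rewrite big_pred0 ?mulr0 // => b.
  exact/negbTE/h.
case: (@arg_maxP _ _ _ b0 (fun b => x b < x a2) x hb0) => b1 hb1 b1max.
have : ~~ P b1 by apply/negP => /a2min; rewrite leNgt hb1.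
rewrite /P -ltNge => /ltW; congr (2 * _ <= _); apply: eq_bigl => b.
by apply/idP/idP => [/le_lt_trans/(_ hb1)|/b1max].
Qed.

(** After subtracting a median [c], the positive and negative parts are each supported on at most
    half of the mass. Centering makes the shift increase the left side, and taking the two parts
    does not increase the right side. *)
Lemma cheeger x : \sum_a deg a * x a = 0 ->
  phi ^+ 2 * \sum_a deg a * x a ^+ 2 <= \sum_a \sum_b w a b * (x a - x b) ^+ 2.
Proof.
move=> xmean; have [T0|T0] := posnP #|T|.
  by rewrite !(big_pred0 _ _ _ _ (fun a => _)) ?mulr0 //; move=> a; have := card0_eq T0 a.
have [c [cgt clt]] := exists_median x T0.
pose yp a := Num.max (x a - c) 0; pose ym a := Num.max (c - x a) 0.
have yp0 a : 0 <= yp a by rewrite le_max lexx orbT.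
have ym0 a : 0 <= ym a by rewrite le_max lexx orbT.
have hp : 2 * \sum_(a | yp a != 0) deg a <= tot.
  rewrite (eq_bigl (fun a => c < x a)) // => a; rewrite /yp.
  by case: (lerP (x a - c) 0) => h; rewrite ?eqxx; lra.
have hm : 2 * \sum_(a | ym a != 0) deg a <= tot.
  rewrite (eq_bigl (fun a => x a < c)) // => a; rewrite /ym.
  by case: (lerP (c - x a) 0) => h; rewrite ?eqxx; lra.
have := lerD (cheeger_nonneg yp0 hp) (cheeger_nonneg ym0 hm).
rewrite -mulrDr -!big_split /= => hsum.
have tot0 : 0 <= tot by apply: sumr_ge0 => a _; exact: deg_ge0.
apply: (@le_trans _ _ (phi ^+ 2 * \sum_a (deg a * yp a ^+ 2 + deg a * ym a ^+ 2))).
  rewrite ler_wpM2l ?sqr_ge0 //.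
  have -> : \sum_a (deg a * yp a ^+ 2 + deg a * ym a ^+ 2) = \sum_a deg a * (x a - c) ^+ 2.
    apply: eq_bigr => a _; rewrite /yp /ym -mulrDr; congr (_ * _).
    by case: (lerP (x a - c) 0) => h1; case: (lerP (c - x a) 0) => h2; rewrite ?expr0n /=; nra.
  have -> : \sum_a deg a * (x a - c) ^+ 2
     = \sum_a deg a * x a ^+ 2 - 2 * c * \sum_a deg a * x a + c ^+ 2 * tot.
    rewrite /tot !mulr_sumr -sumrB -big_split /=; apply: eq_bigr => a _; ring.
  by rewrite xmean mulr0 subr0 lerDl mulr_ge0 ?sqr_ge0.
apply: le_trans hsum _; apply: ler_sum => a _; rewrite -big_split /=; apply: ler_sum => b _.
rewrite -mulrDr ler_wpM2l // /yp /ym.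
case: (lerP (x a - c) 0) => h1; case: (lerP (c - x a) 0) => h2;
case: (lerP (x b - c) 0) => h3; case: (lerP (c - x b) 0) => h4; nra.
Qed.
End Cheeger.

(** * Local estimates in links *)

Section UpperWeights.
Variables (R : comNzRingType) (T : finType) (mu : {set T} -> R) (k : nat).
Implicit Types (U S A : {set T}).

Definition upw U : R := \sum_(S : {set T} | (U \subset S) && (#|S| == k)) mu S.

Lemma sum_mulrn_cardI (Q : pred {set T}) A :
  \sum_(S : {set T} | Q S) mu S *+ #|S :&: A|
  = \sum_(a in A) \sum_(S : {set T} | Q S && (a \in S)) mu S.
Proof.
under [RHS]eq_bigr => a _ do rewrite big_mkcondr.
rewrite exchange_big /=; apply: eq_bigr => S _.
rewrite -big_mkcondr sumr_const; congr (_ *+ _).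
by apply: eq_card => a; rewrite !inE andbC.
Qed.

Lemma upw_setU1 U a : upw (a |: U)
  = \sum_(S : {set T} | ((U \subset S) && (#|S| == k)) && (a \in S)) mu S.
Proof. by apply: eq_bigl => S; rewrite subUset sub1set -andbA andbC. Qed.

Lemma sum_upw_setU1 U : (#|U| <= k)%N ->
  \sum_(a | a \notin U) upw (a |: U) = upw U *+ (k - #|U|).
Proof.
move=> Uk; under eq_bigr => a _ do rewrite upw_setU1.
under eq_bigl => a do rewrite -in_setC.
rewrite -sum_mulrn_cardI -sumrMnl; apply: eq_bigr => S /andP[US /eqP Sk].
congr (_ *+ _); rewrite -setDE.
by rewrite -(cardsID U S) (setIidPr US) in Sk; lia.
Qed.
End UpperWeights.

Section SlicePoly.
Variables (R : comNzRingType) (T : finType) (mu : {set T} -> R).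
Variables (Q : pred {set T}) (A : {set T}).

(** An unnormalised generating function of [#|S :&: A|]; its derivatives at 1 are factorial moments,
    hence sums of link weights. *)
Definition slice_poly : {poly R} := \sum_(S : {set T} | Q S) mu S *: 'X^#|S :&: A|.

Lemma slice_poly1 : slice_poly.[1] = \sum_(S : {set T} | Q S) mu S.
Proof.
by rewrite horner_sum; apply: eq_bigr => S _; rewrite hornerZ hornerXn expr1n mulr1.
Qed.

Lemma deriv_slice_poly1 : slice_poly^`().[1]
  = \sum_(a in A) \sum_(S : {set T} | Q S && (a \in S)) mu S.
Proof.
rewrite -sum_mulrn_cardI /slice_poly (big_morph _ (@derivD R) (@deriv0 R)) horner_sum.
apply: eq_bigr => S _.
by rewrite derivZ derivXn hornerZ hornerMn hornerXn expr1n mulr_natr.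
Qed.

Lemma deriv2_slice_poly1 : slice_poly^`()^`().[1]
  = \sum_(a in A) \sum_(b in A :\ a)
      \sum_(S : {set T} | (Q S && (a \in S)) && (b \in S)) mu S.
Proof.
rewrite /slice_poly !(big_morph _ (@derivD R) (@deriv0 R)) horner_sum.
under [RHS]eq_bigr => a _ do rewrite -sum_mulrn_cardI big_mkcondr.
rewrite exchange_big /=; apply: eq_bigr => S _.
rewrite -big_mkcondr (eq_bigr (fun=> mu S *+ (#|S :&: A|.-1))).
  rewrite sumr_const !derivZ derivXn derivMn derivXn hornerZ !hornerMn hornerXn expr1n.
  rewrite mulrnAr mulr_natr -!mulrnA; congr (_ *+ _).
  by congr (_ * _)%N; apply: eq_card => a; rewrite !inE andbC.
move=> a /andP[aA aS]; congr (_ *+ _).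
rewrite (cardsD1 a (S :&: A)) inE aA aS /=; congr #|pred_of_set _|.
by apply/setP => b; rewrite !inE andbCA.
Qed.
End SlicePoly.

Section LocalEstimates.
Variables (R : realType) (T : finType) (mu : {set T} -> R) (k : nat).
Local Notation C := R[i].
Local Notation toC := (real_complex R).
Implicit Types (U V S A : {set T}).

Hypothesis mu_gt0 : forall S, 0 < mu S.
Hypothesis gen_poly_neq0 : forall U V (z : T -> C), U \subset V ->
  (forall i, i \in V :\: U -> 0 <= Re (z i)) -> (gen_poly mu U V z).[1] != 0.
Hypothesis k_le : (k <= #|T|)%N.

Local Notation m := (upw mu k).

Lemma upw_ge0 U : 0 <= m U.
Proof. by rewrite sumr_ge0 // => S _; rewrite ltW. Qed.

Lemma upw_gt0 U : (#|U| <= k)%N -> 0 < m U.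
Proof.
move=> Uk.
have : (0 < #|[set B : {set T} | B \subset ~: U & #|B| == (k - #|U|)%N]|)%N.
  by rewrite cards_draws bin_gt0 [leqRHS]cardsCs setCK; lia.
move=> /card_gt0P[B]; rewrite inE => /andP[BU /eqP Bk].
have US : (U \subset U :|: B) && (#|U :|: B| == k).
  rewrite subsetUl cardsU.
  have -> : U :&: B = set0 by apply/eqP; rewrite setIC setI_eq0 disjoints_subset.
  by rewrite cards0 Bk; apply/eqP; lia.
rewrite /upw (bigD1 (U :|: B) US) /= ltr_pwDl // sumr_ge0 // => S _; exact: ltW.
Qed.

Lemma map_slice_polyE (Q : pred {set T}) A (x : C) :
  (map_poly toC (slice_poly mu Q A)).[x]
  = \sum_(S : {set T} | Q S) (mu S)%:C%C * x ^+ #|S :&: A|.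
Proof.
rewrite /slice_poly rmorph_sum horner_sum; apply: eq_bigr => S _.
by rewrite /= map_polyZ hornerZ map_polyXn hornerXn.
Qed.

(** The weights serve [link_pair_covariance]: weighting a single element i puts an arbitrary
    positive constant between the sets containing i and the others. *)
Lemma weighted_slice_neq0 U V A (w : T -> R) (x : C) :
  U \subset V -> A \subset ~: U -> (#|U| <= k <= #|V|)%N ->
  (forall i, 0 < w i) -> 0 < Re x ->
  \sum_(S : {set T} | [&& U \subset S, S \subset V & #|S| == k])
    (\prod_(i in S :\: U) (w i)%:C%C) * (mu S)%:C%C * x ^+ #|S :&: A| != 0.
Proof.
move=> UV AU /andP[Uk kV] w0 hx.
have UVk : (k - #|U| <= #|V :\: U|)%N.
  by have := cardsID U V; rewrite (setIidPr UV); lia.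
have := slice_hurwitz mu_gt0 gen_poly_neq0 A UV w0 UVk hx.
apply: contraNneq => h; apply/eqP; rewrite -[RHS]h; apply: eq_big => [S|S /andP[/andP[US SV] _]].
  rewrite /interval -!andbA; case: (boolP (U \subset S)) => //= US; congr (_ && _).
  by have := cardsID U S; rewrite (setIidPr US) => hS; apply/eqP/eqP; lia.
congr (_ * _ ^+ _); apply: eq_card => a; rewrite !inE.
case: (boolP (a \in A)) => aA; rewrite ?andbF // !andbT.
by have := subsetP AU _ aA; rewrite inE => ->.
Qed.

Lemma slice_neq0 U V A (x : C) :
  U \subset V -> A \subset ~: U -> (#|U| <= k <= #|V|)%N -> 0 < Re x ->
  (map_poly toC (slice_poly mu
     (fun S => [&& U \subset S, S \subset V & #|S| == k]) A)).[x] != 0.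
Proof.
move=> UV AU hk hx; rewrite map_slice_polyE.
have := weighted_slice_neq0 UV AU hk (fun=> ltr01) hx.
apply: contraNneq => h; apply/eqP; rewrite -[RHS]h; apply: eq_bigr => S _.
by rewrite big1 ?mul1r // => i _; rewrite rmorph1.
Qed.

Section Link.
Variable U : {set T}.

(** [link1] and [link2] weight the vertices and edges of the link of [U]; the extension by 0 lets
    sums range over all of [T]. *)
Definition link1 a : R := if a \in U then 0 else m (a |: U).
Definition link2 a b : R :=
  if [|| a \in U, b \in U | a == b] then 0 else m (a |: (b |: U)).

Lemma link1_ge0 a : 0 <= link1 a.
Proof. by rewrite /link1; case: ifP => // _; exact: upw_ge0. Qed.

Lemma link2_ge0 a b : 0 <= link2 a b.
Proof. by rewrite /link2; case: ifP => // _; exact: upw_ge0. Qed.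

Lemma link2_sym a b : link2 a b = link2 b a.
Proof. by rewrite /link2 orbCA eq_sym setUCA. Qed.

Lemma link2_diag a : link2 a a = 0.
Proof. by rewrite /link2 eqxx !orbT. Qed.

Lemma sum_link1 : (#|U| <= k)%N -> \sum_a link1 a = m U *+ (k - #|U|).
Proof.
move=> Uk; rewrite -sum_upw_setU1 // [RHS]big_mkcond; apply: eq_bigr => a _.
by rewrite /link1; case: (a \in U).
Qed.

Lemma sum_link2 a : (#|U| < k)%N -> \sum_b link2 a b = link1 a *+ (k - #|U|).-1.
Proof.
move=> Uk; rewrite /link1; have [aU|aU] := boolP (a \in U).
  by rewrite mul0rn big1 // => b _; rewrite /link2 aU.
have -> : ((k - #|U|).-1 = k - #|a |: U|)%N by rewrite cardsU1 aU; lia.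
rewrite -sum_upw_setU1; last by rewrite cardsU1 aU.
rewrite [RHS]big_mkcond; apply: eq_bigr => b _.
rewrite /link2 (negPf aU) !inE negb_or /= eq_sym setUCA.
by case: (b \in U); case: (b == a).
Qed.

Hypothesis Uk : (#|U| < k)%N.

(** Let [a] and [b] be the slice polynomials of the k-sets above [U] with and without [i]. A weight
    on [i] shows that [a + c b] has no root in the right half-plane for c > 0, so the Schwarz lemma
    applies to both [a / b] and [b / a]. The Wronskian at 1 is the sum of covariances, and [b.[1] <=
    m U]. *)
Lemma link_pair_covariance i A : i \notin U -> A \subset ~: (i |: U) ->
  `|\sum_(a in A) (link2 i a * m U - link1 i * link1 a)| <= 2 * (link1 i * m U).
Proof.
move=> iU Ai.
have aP a : a \in A -> a \notin U /\ a != i.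
  by move=> /(subsetP Ai); rewrite !inE negb_or => /andP[].
pose mi := m (i |: U).
have l1i : link1 i = mi by rewrite /link1 (negPf iU).
have mi0 : 0 <= mi by exact: upw_ge0.
have mU0 : 0 < m U by rewrite upw_gt0 // ltnW.
(* For [k = #|T|] no k-set avoids [i] and [b] would be 0, but then every covariance vanishes. *)
have [kT|kT] := eqVneq k #|T|.
  have mE V : m V = mu setT.
    rewrite /upw (big_pred1 setT) // => S /=; rewrite kT -cardsT.
    apply/andP/eqP => [[_ /eqP hS]|->]; last by rewrite subsetT.
    by apply/eqP; rewrite eqEcard subsetT hS leqnn.
  rewrite big1 ?normr0 => [|a /aP[aU ai]]; first by rewrite l1i mulr_ge0 // mulr_ge0 // ltW.
  by rewrite /link1 /link2 (negPf iU) (negPf aU) eq_sym (negPf ai) /= !mE subrr.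
pose Qa S := [&& i |: U \subset S, S \subset [set: T] & #|S| == k].
pose Qb S := [&& U \subset S, S \subset ~: [set i] & #|S| == k].
pose a := slice_poly mu Qa A; pose b := slice_poly mu Qb A.
have QaE : forall S, Qa S = ((i |: U) \subset S) && (#|S| == k).
  by move=> S; rewrite /Qa subsetT.
have QbE : forall S, Qb S = ((U \subset S) && (#|S| == k)) && (i \notin S).
  by move=> S; rewrite /Qb subsetC sub1set inE andbA andbAC.
have a1 : a.[1] = mi by rewrite slice_poly1 (eq_bigl _ _ QaE).
have split_i (P : pred {set T}) : \sum_(S : {set T} | P S) mu S =
    \sum_(S : {set T} | P S && (i \in S)) mu S + \sum_(S : {set T} | P S && (i \notin S)) mu S.
  exact: bigID.
have b1 : b.[1] = m U - mi.
  rewrite slice_poly1 (eq_bigl _ _ QbE) /mi upw_setU1 /upw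
    (split_i (fun S => (U \subset S) && (#|S| == k))).
  by rewrite addrC addKr.
have da : a^`().[1] = \sum_(j in A) link2 i j.
  rewrite deriv_slice_poly1; apply: eq_bigr => j /aP[jU ji].
  rewrite /link2 (negPf iU) (negPf jU) eq_sym (negPf ji) /= setUCA upw_setU1.
  by apply: eq_bigl => S; rewrite QaE.
have db : b^`().[1] = \sum_(j in A) (link1 j - link2 i j).
  rewrite deriv_slice_poly1; apply: eq_bigr => j /aP[jU ji].
  rewrite /link1 (negPf jU) /link2 (negPf iU) (negPf jU) eq_sym (negPf ji) /=.
  rewrite [m (i |: _)]upw_setU1 [m (j |: U)]upw_setU1.
  rewrite (split_i (fun S => ((U \subset S) && (#|S| == k)) && (j \in S))).
  rewrite [X in _ = _ + _ - X](eq_bigl (fun S =>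
    ((U \subset S) && (#|S| == k) && (j \in S)) && (i \in S))).
    by rewrite addrC addKr; apply: eq_bigl => S; rewrite QbE andbAC.
  by move=> S; rewrite subUset sub1set; case: (j \in S); rewrite /= ?andbF ?andbT.
have key : a^`().[1] * b.[1] - a.[1] * b^`().[1]
   = \sum_(j in A) (link2 i j * m U - link1 i * link1 j).
  rewrite da db a1 b1 l1i mulr_suml mulr_sumr -sumrB; apply: eq_bigr => j _; ring.
have AU : A \subset ~: U by apply: subset_trans Ai _; rewrite setCS subsetUr.
have hk1 : (#|i |: U| <= k <= #|[set: T]|)%N by rewrite cardsU1 iU cardsT k_le add1n Uk.
have iV : U \subset ~: [set i] by rewrite subsetC sub1set inE.
have hk2 : (#|U| <= k <= #|~: [set i]|)%N.
  by rewrite ltnW //= cardsC1; move: k_le; rewrite leq_eqVlt (negPf kT) /=; lia.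
have a_neq0 (x : C) : 0 < Re x -> (map_poly toC a).[x] != 0.
  by move=> hx; apply: slice_neq0 => //; rewrite ?subsetT.
have b_neq0 (x : C) : 0 < Re x -> (map_poly toC b).[x] != 0.
  by move=> hx; apply: slice_neq0.
have ab_neq0 (x : C) : 0 < Re x -> forall c : R, 0 < c ->
    (map_poly toC a).[x] + c%:C%C * (map_poly toC b).[x] != 0.
  move=> hx c c0; pose w j := if j == i then c^-1 else 1.
  have w0 j : 0 < w j by rewrite /w; case: ifP => _; rewrite ?invr_gt0.
  have hk3 : (#|U| <= k <= #|[set: T]|)%N by rewrite ltnW //= cardsT.
  have := weighted_slice_neq0 (subsetT U) AU hk3 w0 hx.
  apply: contraNneq => h; apply/eqP.
  have cc : c%:C%C != 0 by rewrite fmorph_eq0 gt_eqF.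
  apply: (mulfI cc); rewrite mulr0 -[RHS]h !map_slice_polyE.
  rewrite (bigID (fun S : {set T} => i \in S)) /= mulrDr; congr (_ + _).
    rewrite mulr_sumr; apply: eq_big => [S|S /andP[_ iS]].
      by rewrite QaE subUset sub1set subsetT; case: (i \in S); rewrite /= ?andbF ?andbT.
    rewrite (bigD1 i) ?inE ?iU //= big1 => [|j /andP[_ /negPf ji]]; last by rewrite /w ji rmorph1.
    by rewrite /w eqxx fmorphV mulr1 !mulrA mulfV // mul1r.
  rewrite !mulr_sumr; apply: eq_big => [S|S /andP[_ iS]].
    by rewrite QbE subsetT.
  rewrite big1 ?mul1r // => j; rewrite inE => /andP[_ jS].
  by rewrite /w ifN ?rmorph1 //; apply: contraNneq iS => <-.
have mi_gt0 : 0 < mi by rewrite upw_gt0 // cardsU1 iU.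
have b_gt0 : 0 < b.[1].
  have [h|h] := ltrP 0 b.[1]; first by [].
  have b10 : b.[1] = 0.
    apply/eqP; rewrite eq_le h slice_poly1 sumr_ge0 // => S _; exact: ltW.
  have := b_neq0 1 ltr01.
  by rewrite -{1}(rmorph1 toC) horner_map /= b10 eqxx.
have a_gt0 : 0 < a.[1] by rewrite a1.
have s1 := @schwarz_slit_plane R a b a_gt0 b_gt0 _ b_neq0.
have s2 := @schwarz_slit_plane R b a b_gt0 a_gt0 _ a_neq0.
have {}s1 : a^`().[1] * b.[1] - a.[1] * b^`().[1] <= 2 * (a.[1] * b.[1]).
  apply: s1 => x hx c; rewrite le_eqVlt => /orP[/eqP <-|c0]; last exact: ab_neq0.
  by rewrite rmorph0 mul0r addr0 a_neq0.
have {}s2 : b^`().[1] * a.[1] - b.[1] * a^`().[1] <= 2 * (b.[1] * a.[1]).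
  apply: s2 => x hx c; rewrite le_eqVlt => /orP[/eqP <-|c0].
    by rewrite rmorph0 mul0r addr0 b_neq0.
  have cc : c%:C%C != 0 by rewrite fmorph_eq0 gt_eqF.
  have ci : 0 < c^-1 by rewrite invr_gt0.
  have := ab_neq0 x hx _ ci; apply: contraNneq => h; apply/eqP.
  apply: (mulfI cc); rewrite mulr0 -[RHS]h mulrDr mulrA fmorphV mulfV // mul1r addrC.
  by [].
have b1le : b.[1] <= m U by rewrite b1 lerBlDr lerDl.
rewrite -key l1i -a1 ler_norml.
have := ler_wpM2l (ltW a_gt0) b1le.
move: s1 s2; lra.
Qed.

(** Summing separately the positive and the negative covariances costs 2 + 2 = 4. The diagonal is
    set to 0. *)
Lemma link_covariance_row i :
  \sum_a `|link2 i a * m U - (i != a)%:R * (link1 i * link1 a)| <= 4 * (link1 i * m U).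
Proof.
have [iU|iU] := boolP (i \in U).
  rewrite big1 => [|a _]; first by rewrite /link1 iU mul0r mulr0.
  by rewrite /link2 /link1 iU /= !mul0r mulr0 subr0 normr0.
pose F a := link2 i a * m U - link1 i * link1 a.
pose A := [set a | (a \notin i |: U) && (0 <= F a)].
pose B := [set a | (a \notin i |: U) && (F a < 0)].
have AS : A \subset ~: (i |: U) by apply/subsetP => a; rewrite !inE => /andP[].
have BS : B \subset ~: (i |: U) by apply/subsetP => a; rewrite !inE => /andP[].
have hA : `|\sum_(a in A) F a| <= 2 * (link1 i * m U) := link_pair_covariance iU AS.
have hB : `|\sum_(a in B) F a| <= 2 * (link1 i * m U) := link_pair_covariance iU BS.
have -> : \sum_a `|link2 i a * m U - (i != a)%:R * (link1 i * link1 a)|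
   = \sum_(a in A) F a - \sum_(a in B) F a.
  rewrite -sumrN (big_mkcond (fun a => a \in A)) (big_mkcond (fun a => a \in B)) -big_split /=.
  apply: eq_bigr => a _; rewrite !inE negb_or.
  have [ai|ai] := eqVneq a i; first by rewrite ai link2_diag !mul0r subr0 normr0 addr0.
  have [aU|aU] := boolP (a \in U).
    by rewrite /link2 /link1 aU orbT mul0r !mulr0 subr0 normr0 addr0.
  rewrite /= mul1r -/(F a); case: (lerP 0 (F a)) => hF;
  by rewrite ?addr0 ?add0r ?(ger0_norm hF) ?(ltr0_norm hF).
move: hA hB; rewrite !ler_norml => /andP[_ hA] /andP[hB _].
lra.
Qed.

(** For centered [x] the product weights contribute only minus a sum of squares once their diagonal
    is removed; the remaining covariance matrix is bounded by its absolute row sums, by Schur's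
    test. *)
Lemma link_quadratic_form_le x : \sum_a link1 a * x a = 0 ->
  \sum_a \sum_b link2 a b * x a * x b <= 4 * \sum_a link1 a * x a ^+ 2.
Proof.
move=> xmean; have mU0 : 0 < m U by rewrite upw_gt0 // ltnW.
pose G a b := link2 a b * m U - (a != b)%:R * (link1 a * link1 b).
have Gsym a b : G a b = G b a by rewrite /G link2_sym eq_sym [link1 a * _]mulrC.
rewrite -(ler_pM2r mU0).
have -> : (\sum_a \sum_b link2 a b * x a * x b) * m U
   = \sum_a \sum_b G a b * x a * x b - \sum_a (link1 a * x a) ^+ 2.
  have sq : \sum_a \sum_b (link1 a * x a) * (link1 b * x b) = 0.
    by rewrite -big_distrlr /= xmean mul0r.
  rewrite -[LHS](subr0) -[X in _ - X]sq mulr_suml -!sumrB; apply: eq_bigr => a _.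
  rewrite mulr_suml -sumrB [in RHS](bigD1 a) // [in LHS](bigD1 a) //= /G eqxx link2_diag.
  rewrite !mul0r subrr mul0r mul0r.
  have -> : \sum_(b | b != a) (link2 a b * x a * x b * m U - link1 a * x a * (link1 b * x b))
     = \sum_(b | b != a) (link2 a b * m U - (a != b)%:R * (link1 a * link1 b)) * x a * x b.
    by apply: eq_bigr => b ba; rewrite (eq_sym a) ba mul1r; ring.
  by ring.
apply: (@le_trans _ _ (\sum_a \sum_b `|G a b| * ((x a ^+ 2 + x b ^+ 2) / 2))).
  rewrite lerBlDr ler_wpDr //; first by rewrite sumr_ge0 // => a _; exact: sqr_ge0.
  apply: ler_sum => a _; apply: ler_sum => b _; rewrite -mulrA.
  apply: le_trans (ler_norm _) _; rewrite normrM ler_wpM2l // ler_norml.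
  by have := sqr_ge0 (x a + x b); have := sqr_ge0 (x a - x b); nra.
have half : \sum_a \sum_b `|G a b| * (x a ^+ 2 / 2) <= 2 * m U * \sum_a link1 a * x a ^+ 2.
  rewrite mulr_sumr; apply: ler_sum => a _; rewrite -mulr_suml.
  have := link_covariance_row a; rewrite -/(G a _) => h.
  have := ler_wpM2r (sqr_ge0 (x a)) h; lra.
have half2 : \sum_a \sum_b `|G a b| * (x b ^+ 2 / 2) <= 2 * m U * \sum_a link1 a * x a ^+ 2.
  rewrite exchange_big /=; apply: le_trans half.
  by apply: ler_sum => a _; apply: ler_sum => b _; rewrite Gsym.
have -> : \sum_a \sum_b `|G a b| * ((x a ^+ 2 + x b ^+ 2) / 2)
   = \sum_a \sum_b `|G a b| * (x a ^+ 2 / 2) + \sum_a \sum_b `|G a b| * (x b ^+ 2 / 2).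
  rewrite -big_split; apply: eq_bigr => a _; rewrite -big_split; apply: eq_bigr => b _ /=; ring.
lra.
Qed.

(** With s the link mass of [A], the weight of the cut is (n - 1) s minus the second factorial
    moment of [#|S :&: (A :\: U)|], which [hurwitz_deriv2_le] bounds with [D = n]. At n = 2 the
    bound is void. *)
Lemma link_cut A n : n = (k - #|U|)%N -> (1 < n)%N ->
  (n - 2)%:R * (\sum_(a in A) link1 a) * (n%:R * m U - \sum_(a in A) link1 a)
  <= n%:R * m U * \sum_(a in A) \sum_(b | b \notin A) link2 a b.
Proof.
move=> nE n2; set s := \sum_(a in A) link1 a.
have nR : 2 <= n%:R :> R by rewrite ler_nat.
pose A1 := A :\: U.
pose Q S := [&& U \subset S, S \subset [set: T] & #|S| == k].
have QE S : Q S = (U \subset S) && (#|S| == k) by rewrite /Q subsetT.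
pose h := slice_poly mu Q A1.
have A1U : A1 \subset ~: U by apply/subsetP => a; rewrite !inE => /andP[].
have hk : (#|U| <= k <= #|[set: T]|)%N by rewrite ltnW //= cardsT.
have h1 : h.[1] = m U by rewrite slice_poly1 (eq_bigl _ _ QE).
have mU0 : 0 < m U by rewrite upw_gt0 // ltnW.
have h'1 : h^`().[1] = s.
  rewrite deriv_slice_poly1 /s (big_mkcond (fun a => a \in A)) (big_mkcond (fun a => a \in A1)) /=.
  apply: eq_bigr => a _; rewrite /A1 !inE /link1.
  case: (a \in A); case: (a \in U) => //=.
  by rewrite upw_setU1; apply: eq_bigl => S; rewrite QE.
have h''1 : h^`()^`().[1] = \sum_(a in A) \sum_(b in A) link2 a b.
  rewrite deriv2_slice_poly1 (big_mkcond (fun a => a \in A)) (big_mkcond (fun a => a \in A1)) /=.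
  apply: eq_bigr => a _; rewrite /A1 !inE.
  case: (boolP (a \in A)) => aA; last by rewrite andbF.
  have [aU|aU] /= := boolP (a \in U).
    by rewrite big1 // => b _; rewrite /link2 aU.
  rewrite (big_mkcond (fun b => b \in A)) (big_mkcond (fun b => b \in _ :\ _)) /=.
  apply: eq_bigr => b _; rewrite !inE /link2 (negPf aU) (eq_sym a).
  have [->|ba] /= := eqVneq b a; first by rewrite orbT if_same.
  rewrite orbF; case: (b \in A); case: (b \in U) => //=.
  rewrite upw_setU1; apply: eq_bigl => S; rewrite QE subUset sub1set.
  by case: (a \in S); case: (b \in S); rewrite /= ?andbT ?andbF.
have sz : (size h <= n.+1)%N.
  apply: (leq_trans (size_sum _ _ _)); apply/bigmax_leqP => S /and3P[US _ /eqP Sk].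
  rewrite (leq_trans (size_scale_leq _ _)) // size_polyXn ltnS.
  have := cardsID U S; rewrite (setIidPr US) Sk => hS.
  have : (#|S :&: A1| <= #|S :\: U|)%N.
    by apply: subset_leq_card; apply/subsetP => a; rewrite !inE => /andP[-> /andP[->]].
  by lia.
have hroot (x : C) : 0 < Re x -> (map_poly toC h).[x] != 0.
  by move=> hx; apply: slice_neq0 => //; rewrite subsetT.
have := @hurwitz_deriv2_le R h n _ sz _ hroot.
rewrite h1 h'1 h''1 => /(_ ltac:(lia) mU0).
set q := \sum_(a in A) \sum_(b in A) link2 a b => hq.
have -> : \sum_(a in A) \sum_(b | b \notin A) link2 a b = (n%:R - 1) * s - q.
  rewrite /s /q mulr_sumr -sumrB; apply: eq_bigr => a aA.
  have := sum_link2 a Uk; rewrite (bigID (fun b => b \in A)) /= -nE => hsum.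
  apply: (addrI (\sum_(b in A) link2 a b)); rewrite hsum addrC subrK.
  by rewrite -[link1 a *+ _]mulr_natl -subn1 natrB // ltnW.
have n0 : n%:R != 0 :> R by rewrite gt_eqF //; lra.
rewrite natrB //.
have hq2 : n%:R * (q * m U) <= n%:R * (s ^+ 2 + m U * s) - 2 * s ^+ 2.
  have -> : n%:R * (s ^+ 2 + m U * s) - 2 * s ^+ 2
    = n%:R * (s ^+ 2 + m U * s - 2 / n%:R * s ^+ 2) by field.
  by rewrite ler_wpM2l.
move: hq2; set M := m U; clear; nra.
Qed.

(** When [A] has at most half of the mass, [link_cut] gives a cut of at least (n - 2) s / 2, which
    is at least (n - 1) s / 4 because n >= 3. So the conductance is 1/4, and the gap 1/16 over
    ordered pairs becomes 1 - 1/32 for the quadratic form. *)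
Lemma link_cheeger x : (#|U|.+2 < k)%N -> \sum_a link1 a * x a = 0 ->
  \sum_a \sum_b link2 a b * x a * x b
    <= 31%:R / 32%:R * (k - #|U|).-1%:R * \sum_a link1 a * x a ^+ 2.
Proof.
move=> Uk3 xmean; set n := (k - #|U|)%N.
have n3 : (3 <= n)%N by rewrite /n; lia.
have nR : 3 <= n%:R :> R by rewrite ler_nat.
have mU0 : 0 < m U by rewrite upw_gt0 // ltnW.
have degE a : \sum_b link2 a b = n.-1%:R * link1 a by rewrite sum_link2 // mulr_natl.
have totE : \sum_a \sum_b link2 a b = n.-1%:R * (n%:R * m U).
  under eq_bigr => a _ do rewrite degE.
  by rewrite -mulr_sumr sum_link1 1?ltnW // [n%:R * m U]mulr_natl.
have n1R : n.-1%:R = n%:R - 1 :> R by rewrite -subn1 natrB //; lia.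
have cut A : 2 * \sum_(a in A) \sum_b link2 a b <= \sum_a \sum_b link2 a b ->
  1 / 4 * \sum_(a in A) \sum_b link2 a b <= \sum_(a in A) \sum_(b | b \notin A) link2 a b.
  have -> : \sum_(a in A) \sum_b link2 a b = n.-1%:R * \sum_(a in A) link1 a.
    by rewrite mulr_sumr; apply: eq_bigr => a _; rewrite degE.
  rewrite totE; have := @link_cut A n erefl (ltnW n3).
  set s := \sum_(a in A) link1 a; set c := \sum_(a in A) \sum_(b | b \notin A) link2 a b.
  have s0 : 0 <= s by apply: sumr_ge0 => a _; exact: link1_ge0.
  rewrite natrB; last by lia.
  rewrite n1R mulrCA ler_pM2l; last by lra.
  set M := m U => hc hs.
  have nM : 0 < n%:R * M by rewrite mulr_gt0 //; lra.
  rewrite -(ler_pM2l nM); apply: le_trans hc.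
  have : (n%:R - 2) * s * (n%:R * M / 2) <= (n%:R - 2) * s * (n%:R * M - s).
    by rewrite ler_wpM2l //; [rewrite mulr_ge0 //; lra | lra].
  have n3R : 0 <= n%:R - 3 :> R by lra.
  have : 0 <= (n%:R - 3) * (s * (n%:R * M)) by rewrite mulr_ge0 // mulr_ge0 // ltW.
  by lra.
have := @cheeger R T link2 (1 / 4) link2_ge0 link2_sym _ cut x.
rewrite divr_gt0 // => /(_ isT).
under eq_bigr => a _ do rewrite degE -mulrA.
rewrite -mulr_sumr xmean mulr0 => /(_ erefl).
under eq_bigr => a _ do rewrite degE -mulrA.
rewrite -mulr_sumr; set N := \sum_a link1 a * x a ^+ 2.
have -> : \sum_a \sum_b link2 a b * (x a - x b) ^+ 2
   = 2 * (n.-1%:R * N) - 2 * \sum_a \sum_b link2 a b * x a * x b.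
  have e1 : \sum_a \sum_b link2 a b * x a ^+ 2 = n.-1%:R * N.
    by rewrite mulr_sumr; apply: eq_bigr => a _; rewrite -mulr_suml degE mulrA.
  have e2 : \sum_a \sum_b link2 a b * x b ^+ 2 = n.-1%:R * N.
    by rewrite -e1 exchange_big /=; apply: eq_bigr => a _; apply: eq_bigr => b _; rewrite link2_sym.
  rewrite mulr2n mulrDl !mul1r -{1}e1 -e2 -big_split mulr_sumr -sumrB; apply: eq_bigr => a _.
  rewrite /= -big_split mulr_sumr -sumrB; apply: eq_bigr => b _ /=; ring.
by lra.
Qed.
End Link.
End LocalEstimates.

(** * Garland's method *)

Section Garland.
Variables (R : realType) (T : finType) (mu : {set T} -> R) (k : nat) (f : {set T} -> R).
Implicit Types (U V S : {set T}).

Hypothesis mu_gt0 : forall S, 0 < mu S.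
Hypothesis k_le : (k <= #|T|)%N.

Local Notation m := (upw mu k).
Local Notation F := (upw (fun S => mu S * f S) k).

(** [F U / m U] is the conditional mean of [f] above [U]. Up to the total mass, [energy j] is the
    second moment of this mean for a uniform j-subset [U] of a [mu]-random k-set. So
    [energy k - energy 0] is the variance of [f] and [energy k - energy l] the Dirichlet form of the
    k <-> l walk. *)
Definition energy j : R :=
  (\sum_(U : {set T} | #|U| == j) F U ^+ 2 / m U) / 'C(k, j)%:R.

Lemma link_variance U (n := (k - #|U|)%N) : (#|U| < k)%N ->
  \sum_(a | a \notin U) F (a |: U) ^+ 2 / m (a |: U) - n%:R * (F U ^+ 2 / m U)
  = \sum_a link1 mu k U a * (F (a |: U) / m (a |: U) - F U / m U) ^+ 2.
Proof.
move=> Uk.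
have mgt V : (#|V| <= k)%N -> 0 < m V by exact: upw_gt0.
have mU0 : 0 < m U by apply: mgt; lia.
pose h1 := link1 (fun S => mu S * f S) k U.
have sl1 : \sum_a link1 mu k U a = n%:R * m U by rewrite sum_link1 ?mulr_natl //; lia.
have sh1 : \sum_a h1 a = n%:R * F U by rewrite sum_link1 ?mulr_natl //; lia.
set g0 := F U / m U.
have lg0 : m U * g0 = F U by rewrite /g0 mulrC divfK // gt_eqF.
pose g1 a := F (a |: U) / m (a |: U).
have lg1 a : link1 mu k U a * g1 a = h1 a.
  rewrite /h1 /link1 /g1; case: ifP => aU; first by rewrite mul0r.
  by rewrite mulrC divfK // gt_eqF // mgt // cardsU1 aU; lia.
have -> : \sum_(a | a \notin U) F (a |: U) ^+ 2 / m (a |: U)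
    = \sum_a link1 mu k U a * g1 a ^+ 2.
  rewrite [LHS]big_mkcond; apply: eq_bigr => a _; rewrite expr2 mulrA lg1.
  by rewrite /h1 /link1 /g1; case: (a \in U); rewrite /= ?mul0r // mulrA -expr2.
have -> : \sum_a link1 mu k U a * (g1 a - g0) ^+ 2
   = \sum_a link1 mu k U a * g1 a ^+ 2 - 2 * g0 * \sum_a h1 a
     + g0 ^+ 2 * \sum_a link1 mu k U a.
  rewrite !mulr_sumr -sumrB -big_split /=; apply: eq_bigr => a _; rewrite -lg1; ring.
by rewrite sh1 sl1 -lg0 /g0; field; rewrite gt_eqF.
Qed.

(** Least squares: in the link, [x] is the conditional mean of the edge function [y], so [y] has a
    known inner product with [x a + x b], while the local bound controls the norm of the latter.
    Expanding the square of the difference gives the inequality. *)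
Lemma link_garland U (lam : R) n : n = (k - #|U|)%N -> (#|U|.+1 < k)%N -> 0 <= lam ->
  (forall x, \sum_a link1 mu k U a * x a = 0 ->
     \sum_a \sum_b link2 mu k U a b * x a * x b
       <= lam * (k - #|U|).-1%:R * \sum_a link1 mu k U a * x a ^+ 2) ->
  n.-1%:R * (2 / (1 + lam)) *
      (\sum_(a | a \notin U) F (a |: U) ^+ 2 / m (a |: U) - n%:R * (F U ^+ 2 / m U))
  <= \sum_(b | b \notin U) \sum_(a | a \notin b |: U)
       F (a |: (b |: U)) ^+ 2 / m (a |: (b |: U))
     - n%:R * n.-1%:R * (F U ^+ 2 / m U).
Proof.
move=> nE Uk lam0 loc.
have mgt V : (#|V| <= k)%N -> 0 < m V by exact: upw_gt0.
have mU0 : 0 < m U by apply: mgt; lia.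
pose l1 := link1 mu k U; pose l2 := link2 mu k U.
pose h1 := link1 (fun S => mu S * f S) k U; pose h2 := link2 (fun S => mu S * f S) k U.
have sl1 : \sum_a l1 a = n%:R * m U by rewrite sum_link1 -?nE ?mulr_natl //; lia.
have sh1 : \sum_a h1 a = n%:R * F U by rewrite sum_link1 -?nE ?mulr_natl //; lia.
have sl2 a : \sum_b l2 a b = n.-1%:R * l1 a by rewrite sum_link2 -?nE ?mulr_natl //; lia.
have sh2 a : \sum_b h2 a b = n.-1%:R * h1 a by rewrite sum_link2 -?nE ?mulr_natl //; lia.
pose g0 := F U / m U.
pose g1 a := F (a |: U) / m (a |: U).
pose g2 a b := F (a |: (b |: U)) / m (a |: (b |: U)).
have lg0 : m U * g0 = F U by rewrite /g0 mulrC divfK // gt_eqF.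
have lg1 a : l1 a * g1 a = h1 a.
  rewrite /l1 /h1 /link1 /g1; case: ifP => aU; first by rewrite mul0r.
  by rewrite mulrC divfK // gt_eqF // mgt // cardsU1 aU; lia.
have lg2 a b : l2 a b * g2 a b = h2 a b.
  rewrite /l2 /h2 /link2 /g2; case: ifP => abU; first by rewrite mul0r.
  rewrite mulrC divfK // gt_eqF // mgt //.
  apply: (@leq_trans (1 + (1 + #|U|))); last by lia.
  by rewrite !cardsU1 leq_add ?leq_b1 // leq_add ?leq_b1.
have g2_sym a b : g2 a b = g2 b a by rewrite /g2 setUCA.
have S2E : \sum_(b | b \notin U) \sum_(a | a \notin b |: U)
       F (a |: (b |: U)) ^+ 2 / m (a |: (b |: U)) = \sum_a \sum_b l2 a b * g2 a b ^+ 2.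
  rewrite [RHS]exchange_big [LHS]big_mkcond; apply: eq_bigr => b _ /=.
  under [RHS]eq_bigr => a _ do rewrite expr2 mulrA lg2 /h2 /link2.
  case: (b \in U) => /=.
    by rewrite big1 // => a _; rewrite orbT mul0r.
  rewrite [LHS]big_mkcond; apply: eq_bigr => a _; rewrite !inE /g2.
  by case: (a \in U); case: (a == b); rewrite /= ?mul0r // mulrA -expr2.
pose x a := g1 a - g0; pose y a b := g2 a b - g0.
set N := \sum_a l1 a * x a ^+ 2; set Y := \sum_a \sum_b l2 a b * y a b ^+ 2.
have NE : \sum_(a | a \notin U) F (a |: U) ^+ 2 / m (a |: U) - n%:R * (F U ^+ 2 / m U) = N.
  by rewrite nE link_variance //; lia.
have YE : \sum_(b | b \notin U) \sum_(a | a \notin b |: U)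
       F (a |: (b |: U)) ^+ 2 / m (a |: (b |: U)) - n%:R * n.-1%:R * (F U ^+ 2 / m U) = Y.
  rewrite S2E /Y /y.
  have -> : \sum_a \sum_b l2 a b * (g2 a b - g0) ^+ 2
     = \sum_a \sum_b l2 a b * g2 a b ^+ 2 - 2 * g0 * \sum_a \sum_b h2 a b
       + g0 ^+ 2 * \sum_a \sum_b l2 a b.
    rewrite !mulr_sumr -sumrB -big_split /=; apply: eq_bigr => a _.
    rewrite !mulr_sumr -sumrB -big_split /=; apply: eq_bigr => b _; rewrite -lg2; ring.
  under [X in _ = _ - _ * X + _]eq_bigr => a _ do rewrite sh2.
  under [X in _ = _ - _ + _ * X]eq_bigr => a _ do rewrite sl2.
  by rewrite -!mulr_sumr sh1 sl1 -lg0 /g0; field; rewrite gt_eqF.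
have l1_0 a : 0 <= l1 a by rewrite /l1 /link1; case: ifP => // _; exact: upw_ge0.
have l2_0 a b : 0 <= l2 a b by rewrite /l2 /link2; case: ifP => // _; exact: upw_ge0.
rewrite NE YE.
have xmean : \sum_a l1 a * x a = 0.
  rewrite /x; under eq_bigr => a _ do rewrite mulrBr lg1 mulrC.
  by rewrite sumrB sh1 -mulr_sumr sl1 -lg0; ring.
have hloc : \sum_a \sum_b l2 a b * x a * x b <= lam * n.-1%:R * N by rewrite nE; exact: loc xmean.
have l2s a b : l2 a b = l2 b a by exact: link2_sym.
have Yx : \sum_a \sum_b l2 a b * y a b * x a = n.-1%:R * N.
  rewrite /N mulr_sumr; apply: eq_bigr => a _; rewrite -mulr_suml.
  have -> : \sum_b l2 a b * y a b = n.-1%:R * (l1 a * x a).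
    rewrite /y; under eq_bigr => b _ do rewrite mulrBr lg2.
    by rewrite sumrB sh2 -mulr_suml sl2 /x -lg1; ring.
  by ring.
have Yx' : \sum_a \sum_b l2 a b * y a b * x b = n.-1%:R * N.
  rewrite -Yx exchange_big /=; apply: eq_bigr => a _; apply: eq_bigr => b _.
  by rewrite l2s /y g2_sym.
have Xx : \sum_a \sum_b l2 a b * x a ^+ 2 = n.-1%:R * N.
  by rewrite /N mulr_sumr; apply: eq_bigr => a _; rewrite -mulr_suml sl2 mulrA.
have Xx' : \sum_a \sum_b l2 a b * x b ^+ 2 = n.-1%:R * N.
  by rewrite -Xx exchange_big /=; apply: eq_bigr => a _; apply: eq_bigr => b _; rewrite l2s.
(* The coefficient maximising 4 t - 2 (1 + lam) t^2, the lower bound obtained for [Y] relative to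
   [n.-1%:R * N]. *)
pose t := (1 + lam)^-1.
have t0 : 0 < t by rewrite invr_gt0; lra.
have tl : t * (1 + lam) = 1 by rewrite mulVf // gt_eqF //; lra.
have : 0 <= \sum_a \sum_b l2 a b * (y a b - t * (x a + x b)) ^+ 2.
  by apply: sumr_ge0 => a _; apply: sumr_ge0 => b _; rewrite mulr_ge0 ?sqr_ge0.
have -> : \sum_a \sum_b l2 a b * (y a b - t * (x a + x b)) ^+ 2
   = Y - 2 * t * (\sum_a \sum_b l2 a b * y a b * x a + \sum_a \sum_b l2 a b * y a b * x b)
     + t ^+ 2 * (\sum_a \sum_b l2 a b * x a ^+ 2 + \sum_a \sum_b l2 a b * x b ^+ 2
                 + 2 * \sum_a \sum_b l2 a b * x a * x b).
  rewrite /Y !mulrDr !mulr_sumr -!big_split -sumrB -!big_split /=; apply: eq_bigr => a _.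
  rewrite !mulr_sumr -!big_split -sumrB -!big_split /=; apply: eq_bigr => b _; ring.
rewrite Yx Yx' Xx Xx' -/t; set K := n.-1%:R * N.
have hq := ler_wpM2l (sqr_ge0 t) hloc.
have -> : n.-1%:R * (2 * t) * N = 2 * t * K by rewrite /K; ring.
have e1 : t ^+ 2 * (lam * n.-1%:R * N) = t * K - t ^+ 2 * K.
  have -> : t * K = t * (t * (1 + lam)) * K by rewrite tl mulr1.
  by rewrite /K; ring.
rewrite e1 in hq.
lra.
Qed.

Lemma sum_setU1_card (Phi : {set T} -> R) i :
  \sum_(U : {set T} | #|U| == i) \sum_(a | a \notin U) Phi (a |: U)
  = i.+1%:R * \sum_(V : {set T} | #|V| == i.+1) Phi V.
Proof.
rewrite (exchange_big_dep predT) //=.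
have -> : i.+1%:R * \sum_(V : {set T} | #|V| == i.+1) Phi V
    = \sum_(V : {set T} | #|V| == i.+1) \sum_(a in V) Phi V.
  by rewrite mulr_sumr; apply: eq_bigr => V /eqP Vi; rewrite sumr_const Vi mulr_natl.
rewrite [RHS](exchange_big_dep predT) //=; apply: eq_bigr => a _.
rewrite [RHS](reindex_onto (fun U => a |: U) (fun V => V :\ a)) /=; last first.
  by move=> V /andP[_ aV]; rewrite setD1K.
apply: eq_big => [U|U _]; last by [].
rewrite setU11 andbT; have [aU|aU] := boolP (a \in U).
  rewrite andbF; apply/esym/negP => /andP[_ /eqP h].
  by have := setD11 a (a |: U); rewrite h aU.
by rewrite setU1K // eqxx !andbT cardsU1 aU eqSS.
Qed.

Let S j := \sum_(U : {set T} | #|U| == j) F U ^+ 2 / m U.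

Lemma binom_ratio i : (i < k)%N ->
  i.+1%:R * 'C(k, i.+1)%:R = (k - i)%:R * 'C(k, i)%:R :> R.
Proof. by move=> _; rewrite -!natrM mul_bin_left. Qed.

Lemma energyE i : (i <= k)%N -> S i = 'C(k, i)%:R * energy i.
Proof.
by move=> ik; rewrite /energy mulrC divfK // pnatr_eq0 -lt0n bin_gt0.
Qed.

Lemma energy_mono i : (i < k)%N -> energy i <= energy i.+1.
Proof.
move=> ik; have h : 0 <= i.+1%:R * S i.+1 - (k - i)%:R * S i.
  rewrite /S -sum_setU1_card mulr_sumr -sumrB; apply: sumr_ge0 => U /eqP Ui.
  rewrite -Ui link_variance ?Ui //; apply: sumr_ge0 => a _.
  rewrite mulr_ge0 ?sqr_ge0 // /link1; case: ifP => // _; exact: upw_ge0.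
move: h; rewrite !energyE ?(ltnW ik) //.
have -> : i.+1%:R * ('C(k, i.+1)%:R * energy i.+1) = (k - i)%:R * 'C(k, i)%:R * energy i.+1.
  by rewrite mulrA binom_ratio.
rewrite [(k - i)%:R * (_ * _)]mulrA -mulrBr.
by rewrite pmulr_rge0 ?subr_ge0 // mulr_gt0 // ltr0n ?subn_gt0 // bin_gt0 ltnW.
Qed.

(** Summed over [U], [link_garland] reads 2 (e1 - e0) <= (1 + lam) (e2 - e0); subtract (1 + lam) (e1
    - e0). *)
Lemma energy_step i (lam : R) : (i.+2 < k)%N -> 0 <= lam ->
  (forall U x, #|U| = i -> \sum_a link1 mu k U a * x a = 0 ->
     \sum_a \sum_b link2 mu k U a b * x a * x b
       <= lam * (k - i).-1%:R * \sum_a link1 mu k U a * x a ^+ 2) ->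
  (1 - lam) * (energy i.+1 - energy i) <= (1 + lam) * (energy i.+2 - energy i.+1).
Proof.
move=> ik lam0 loc; set n := (k - i)%N.
have h : n.-1%:R * (2 / (1 + lam)) * (i.+1%:R * S i.+1 - n%:R * S i)
     <= i.+1%:R * (i.+2%:R * S i.+2) - n%:R * n.-1%:R * S i.
  rewrite /S -!(sum_setU1_card (fun V => F V ^+ 2 / m V)).
  rewrite -(sum_setU1_card (fun V => \sum_(a | a \notin V) F (a |: V) ^+ 2 / m (a |: V))).
  rewrite !mulr_sumr -!sumrB mulr_sumr; apply: ler_sum => U /eqP Ui.
  apply: link_garland => //; rewrite ?Ui //; first by lia.
  by move=> x hx; apply: loc.
have [i1k i2k ik0] : [/\ (i.+1 < k)%N, (i.+2 <= k)%N & (i < k)%N] by split; lia.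
have b1 := binom_ratio ik0; have b2 := binom_ratio i1k.
have nE : (k - i.+1)%N = n.-1 by rewrite /n; lia.
rewrite nE -/n in b1 b2.
move: h; rewrite !energyE ?(ltnW ik0) ?(ltnW i1k) //.
set e0 := energy i; set e1 := energy i.+1; set e2 := energy i.+2.
have -> : i.+1%:R * (i.+2%:R * ('C(k, i.+2)%:R * e2)) = n%:R * n.-1%:R * 'C(k, i)%:R * e2.
  rewrite [i.+2%:R * _]mulrA b2.
  have -> : i.+1%:R * (n.-1%:R * 'C(k, i.+1)%:R * e2)
     = n.-1%:R * (i.+1%:R * 'C(k, i.+1)%:R) * e2 by ring.
  by rewrite b1; ring.
have -> : i.+1%:R * ('C(k, i.+1)%:R * e1) = n%:R * 'C(k, i)%:R * e1 by rewrite mulrA b1.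
have l1 : 0 < 1 + lam by lra.
have c0 : 0 < n%:R * n.-1%:R * 'C(k, i)%:R :> R.
  by rewrite !mulr_gt0 // ltr0n ?bin_gt0 ?(ltnW ik0) // /n; lia.
have -> : n.-1%:R * (2 / (1 + lam)) * (n%:R * 'C(k, i)%:R * e1 - n%:R * ('C(k, i)%:R * e0))
  = n%:R * n.-1%:R * 'C(k, i)%:R * (2 / (1 + lam) * (e1 - e0)) by ring.
have -> : n%:R * n.-1%:R * 'C(k, i)%:R * e2 - n%:R * n.-1%:R * ('C(k, i)%:R * e0)
  = n%:R * n.-1%:R * 'C(k, i)%:R * (e2 - e0) by ring.
rewrite ler_pM2l // mulrAC ler_pdivrMr // => h.
by lra.
Qed.

(* Bounds (increment s levels below the top) / (top increment): the step ratio
   (1 + lam) / (1 - lam) is 63 for the Cheeger value lam = 31/32, and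
   (s + 5) / (s - 3) for the Schwarz value lam = 4 / (s + 1). *)
Fixpoint gap_factor s : R :=
  if s is s'.+1 then
    (if (s' < 3)%N then 63%:R else (s + 5)%:R / (s - 3)%:R) * gap_factor s'
  else 1.

(** From s = 4 on, the factors (s + 5) / (s - 3) telescope to the binomial coefficient C(s + 5,
    8). *)
Lemma gap_factor_le s : 0 <= gap_factor s <= 63%:R ^+ 3 * (s + 5)%:R ^+ 8.
Proof.
have big1 j : 1 <= (j + 5)%:R ^+ 8 :> R.
  by rewrite exprn_ege1 // ler1n addnS.
have [s3|s3] := leqP s 3.
  have h : 0 <= gap_factor s <= 63%:R ^+ 3.
    by case: s s3 => [|[|[|[|]]]] //= _; apply/andP; split; rewrite ?mulr1 //; lra.
  move: h => /andP[-> h]; apply: le_trans h _ => /=.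
  by rewrite ler_peMr // exprn_ge0.
have gE j : gap_factor (j + 3) = 63%:R ^+ 3 * 'C(j + 8, 8)%:R.
  elim: j => [|j IH]; first by rewrite /= binn !mulr1 !exprS expr0 mulr1.
  rewrite addSn [LHS]/=; have -> : (j + 3 < 3)%N = false by lia.
  rewrite IH; have -> : ((j + 3).+1 + 5 = j.+1 + 8)%N by lia.
  have -> : ((j + 3).+1 - 3 = j.+1)%N by lia.
  have hb : (j.+1)%:R * 'C(j.+1 + 8, 8)%:R = (j.+1 + 8)%:R * 'C(j + 8, 8)%:R :> R.
    by rewrite -!natrM; congr _%:R; have := mul_bin_down (j.+1 + 8) 8; rewrite addnK => <-.
  have j0 : j.+1%:R != 0 :> R by rewrite pnatr_eq0.
  apply: (mulfI j0); rewrite [RHS]mulrCA hb; field.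
  by rewrite addrC natr1.
have sE : s = (s - 3 + 3)%N by lia.
rewrite sE gE -sE; have -> : (s - 3 + 8 = s + 5)%N by lia.
have hC : ('C(s + 5, 8) <= (s + 5) ^ 8)%N.
  have h1 : ('C(s + 5, 8) <= (s + 5) ^_ 8)%N by rewrite -bin_ffact leq_pmulr // fact_gt0.
  apply: leq_trans h1 _.
  have -> : ((s + 5) ^ 8 = \prod_(j < 8) (s + 5))%N by rewrite prod_nat_const card_ord.
  by rewrite ffact_prod; apply: leq_prod => j _; exact: leq_subr.
rewrite mulr_ge0 ?ler0n ?exprn_ge0 //=.
by rewrite ler_pM2l ?exprn_gt0 // -natrX ler_nat.
Qed.

Hypothesis local_bound : forall (U : {set T}) x, (#|U|.+2 < k)%N ->
  \sum_a link1 mu k U a * x a = 0 ->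
  \sum_a \sum_b link2 mu k U a b * x a * x b
    <= 31%:R / 32%:R * (k - #|U|).-1%:R * \sum_a link1 mu k U a * x a ^+ 2.
Hypothesis local_bound4 : forall (U : {set T}) x, (#|U| < k)%N ->
  \sum_a link1 mu k U a * x a = 0 ->
  \sum_a \sum_b link2 mu k U a b * x a * x b <= 4 * \sum_a link1 mu k U a * x a ^+ 2.

Lemma energy_increment s : (s.+2 <= k)%N ->
  energy (k - 2 - s).+1%N - energy (k - 2 - s)%N
    <= gap_factor s * (energy k.-1 - energy (k - 2)%N).
Proof.
elim: s => [|s IH] sk.
  by rewrite subn0 mul1r; have -> : (k - 2).+1 = k.-1 by lia.
have {}IH := IH (ltnW sk).
set i := (k - 2 - s.+1)%N; have iE : (k - 2 - s)%N = i.+1 by rewrite /i; lia.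
have ik : (i.+2 < k)%N by rewrite /i; lia.
have nE : (k - i)%N = s.+3 by rewrite /i; lia.
rewrite iE in IH.
set D := energy k.-1 - energy (k - 2)%N in IH *.
set d0 := energy i.+1 - energy i; set d1 := energy i.+2 - energy i.+1 in IH.
(* The links here have rank s + 3. For s < 3 the Schwarz ratio 4 / (s + 2) is at least 1, so
   Cheeger's is taken, which is available from rank 3 on. *)
rewrite [gap_factor _]/=; case: ifP => s3.
  have h31 : 0 <= 31%:R / 32%:R :> R by rewrite divr_ge0.
  have h : (1 - 31%:R / 32%:R) * d0 <= (1 + 31%:R / 32%:R) * d1.
    by apply: energy_step => // U x Ui hx; rewrite -Ui; apply: local_bound; rewrite // Ui.
  by rewrite -mulrA; lra.
have s5 : (4 < s.+2)%N by lia.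
pose lam : R := 4 / s.+2%:R.
have sR : 0 < s.+2%:R :> R by rewrite ltr0n.
have lam0 : 0 <= lam by rewrite divr_ge0.
have h : (1 - lam) * d0 <= (1 + lam) * d1.
  apply: energy_step => // U x Ui hx; rewrite nE /lam divfK ?gt_eqF //.
  by apply: local_bound4 => //; lia.
have {}h : (s.+1 - 3)%:R * d0 <= (s.+1 + 5)%:R * d1.
  have sl : s.+2%:R * lam = 4 by rewrite mulrC divfK // gt_eqF.
  have := ler_wpM2l (ltW sR) h.
  have -> : s.+2%:R * ((1 - lam) * d0) = (s.+2%:R - s.+2%:R * lam) * d0 by ring.
  have -> : s.+2%:R * ((1 + lam) * d1) = (s.+2%:R + s.+2%:R * lam) * d1 by ring.
  rewrite sl.
  have e3 : (s.+1 - 3)%:R = s.+2%:R - 4 :> R.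
    by rewrite -(@natrB _ s.+2 4) ?(ltnW s5).
  rewrite e3.
  have -> : (s.+1 + 5)%:R = s.+2%:R + 4 :> R by rewrite -(natrD _ s.+2 4); congr _%:R; lia.
  by [].
have c0 : 0 < (s.+1 - 3)%:R :> R by rewrite ltr0n; lia.
rewrite -(ler_pM2l c0); apply: le_trans h _.
have -> : (s.+1 - 3)%:R * ((s.+1 + 5)%:R / (s.+1 - 3)%:R * gap_factor s * D)
   = (s.+1 + 5)%:R * (gap_factor s * D) by field; rewrite gt_eqF.
by rewrite ler_wpM2l.
Qed.

(** The last increment occurs on both sides and is kept as it is; the other k - 1 increments are
    each at most [B] times the one from level k - 2. Since s <= k - 2 there, s + 5 is at most k +
    3. *)
Lemma energy_gap : (1 < k)%N ->
  energy k - energy 0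
   <= (1 + k%:R * (63%:R ^+ 3 * (k + 3)%:R ^+ 8)) * (energy k - energy (k - 2)%N).
Proof.
move=> k2; set B := 63%:R ^+ 3 * _.
have B0 : 0 <= B by rewrite mulr_ge0 // exprn_ge0.
pose d j := energy j.+1 - energy j.
have dsum j : \sum_(i < j) d i = energy j - energy 0.
  elim: j => [|j IH]; first by rewrite big_ord0 subrr.
  by rewrite big_ord_recr /= IH /d; ring.
have d_ge0 j : (j < k)%N -> 0 <= d j by move=> jk; rewrite subr_ge0 energy_mono.
have kE : k = (k - 2).+2 by lia.
have k1E : k.-1 = (k - 2).+1 by lia.
have hd (i : 'I_(k - 2).+1) : d i <= B * d (k - 2)%N.
  have ik := ltn_ord i; have [s sE sk] : exists2 s, (k - 2 - s)%N = i & (s <= k - 2)%N.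
    by exists (k - 2 - i)%N; lia.
  rewrite /d -sE; have := @energy_increment s ltac:(lia); rewrite k1E => /le_trans; apply.
  have D0 : 0 <= d (k - 2)%N by apply: d_ge0; lia.
  rewrite ler_wpM2r //; have /andP[_ hs] := gap_factor_le s; apply: le_trans hs _.
  by rewrite /B ler_pM2l ?exprn_gt0 // lerXn2r ?nnegrE ?ler0n // ler_nat; lia.
have : energy k - energy 0 <= d (k - 2).+1%N + k%:R * (B * d (k - 2)%N).
  have -> : energy k - energy 0 = d (k - 2).+1%N + \sum_(i < (k - 2).+1) d i.
    by rewrite dsum /d -kE; ring.
  rewrite lerD2l.
  apply: le_trans (ler_sum _ (fun i _ => hd i)) _.
  rewrite sumr_const card_ord -[leLHS]mulr_natl ler_wpM2r //.
    by rewrite mulr_ge0 // d_ge0 //; lia.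
  by rewrite ler_nat; lia.
have -> : energy k - energy (k - 2)%N = d (k - 2).+1%N + d (k - 2)%N.
  by rewrite /d -kE; ring.
have h1 : 0 <= d (k - 2).+1%N by apply: d_ge0; lia.
have h2 : 0 <= d (k - 2)%N by apply: d_ge0; lia.
have h3 : 0 <= k%:R * B * d (k - 2).+1%N by rewrite !mulr_ge0.
by lra.
Qed.
End Garland.

(** * From the Poincare inequality to the second eigenvalue *)

Section SpectralGap.
Variable R : realType.

Lemma det_rank_one_update (K : comNzRingType) (n : nat) (u : 'cV[K]_n) (v : 'rV[K]_n) (c : K) :
  c * \det (c%:M + u *m v) = (c + (v *m u) 0 0) * c ^+ n.
Proof.
pose M := block_mx (1%:M : 'M_1) (- v) u c%:M.
have detM : \det M = \det (c%:M + u *m v).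
  have : \det (M *m block_mx (1%:M : 'M_1) v 0 1%:M) = \det (c%:M + u *m v).
    rewrite mulmx_block !mulmx1 !mulmx0 !addr0 mul1mx subrr det_lblock det1 mul1r.
    by rewrite addrC.
  by rewrite det_mulmx det_ublock !det1 mul1r mulr1.
have : \det (block_mx (c%:M : 'M_1) v 0 1%:M *m M) = (c + (v *m u) 0 0) * c ^+ n.
  rewrite mulmx_block !mul1mx !mul0mx !add0r mulmx1 mulmxN mul_scalar_mx mul_mx_scalar.
  rewrite addNr det_lblock det_scalar det_mx11 !mxE eqxx mulr1n.
  by congr ((_ + _) * _); apply: eq_bigr => j _; rewrite !mxE.
by rewrite det_mulmx det_ublock det_scalar1 det1 mulr1 detM.
Qed.

(** Deflation: the eigenvalue 1 of [u] is replaced by 0. With c = X - 1 and A the characteristic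
    matrix, A u = c u yields A (c + u v) = c (A + u v); take determinants. *)
Lemma char_poly_deflate (K : idomainType) (n : nat) (P : 'M[K]_n) (u : 'cV[K]_n) (v : 'rV[K]_n) :
  P *m u = u -> (v *m u) 0 0 = 1 ->
  ('X - 1) * char_poly (P - u *m v) = 'X * char_poly P.
Proof.
move=> Pu vu.
pose Pp := map_mx (@polyC K) P; pose up := map_mx (@polyC K) u; pose vp := map_mx (@polyC K) v.
have vup : (vp *m up) 0 0 = 1.
  by rewrite -map_mxM mxE vu.
have Pup : Pp *m up = up by rewrite -map_mxM Pu.
set A := char_poly_mx P; pose c : {poly K} := 'X - 1.
have c0 : c != 0 by rewrite polyXsubC_eq0.
have AE : A *m up = c *: up.
  by rewrite /A /char_poly_mx mulmxBl Pup mul_scalar_mx scalerBl scale1r.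
have A'E : char_poly_mx (P - u *m v) = A + up *m vp.
  rewrite /A /char_poly_mx map_mxB map_mxM opprB addrA; exact: addrAC.
have fac : A *m (c%:M + up *m vp) = c *: char_poly_mx (P - u *m v).
  by rewrite mulmxDr mulmxA AE -scalemxAl mul_mx_scalar A'E [RHS]scalerDr.
have := congr1 determinant fac; rewrite det_mulmx detZ => hdet.
have := det_rank_one_update up vp c; rewrite vup {2}/c subrK => hone.
apply: (mulfI (expf_neq0 n c0)); rewrite /char_poly mulrCA -hdet.
rewrite -/c -/A mulrCA hone; ring.
Qed.

(** Above [theta] the characteristic polynomial of [P] can only have the root 1, and that once, so
    the second entry of the spectrum is at most [theta]. The sign of [theta] excludes the root 0
    created by the deflation and covers the default value 0 of [lambda2]. *)
Lemma lambda2_le (m : nat) (P : 'M[R]_m) (u : 'cV[R]_m) (v : 'rV[R]_m) (theta : R) :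
  0 <= theta -> P *m u = u -> (v *m u) 0 0 = 1 ->
  (forall x, theta < x -> ~~ root (char_poly (P - u *m v)) x) ->
  lambda2 P <= theta.
Proof.
move=> th0 Pu vu noroot.
have cP0 : char_poly P != 0 by rewrite monic_neq0 // char_poly_monic.
have cP'0 : char_poly (P - u *m v) != 0 by rewrite monic_neq0 // char_poly_monic.
have mupE x : theta < x -> mup x (char_poly P) = (x == 1).
  move=> hx; have x0 : 0 < x by apply: le_lt_trans hx.
  have mX : mup x ('X : {poly R}) = 0%N by rewrite mupNroot // rootX gt_eqF.
  have mX1 : mup x ('X - 1 : {poly R}) = (x == 1).
    have := @mup_XsubCX R 1 x 1; rewrite expr1 => ->.
    by rewrite eq_sym; case: (x == 1).
  have := congr1 (mup x) (char_poly_deflate Pu vu).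
  rewrite !mupM ?polyX_eq0 ?polyXsubC_eq0 // (mupNroot (noroot x hx)) addn0 mX add0n.
  by move=> <-.
rewrite /lambda2 /real_spectrum; set rs := rev _.
have rs_mup x : x \in rs -> (0 < mup x (char_poly P))%N.
  rewrite mem_rev -(roots_on_rootsR cP0) => /andP[_].
  by rewrite -XsubC_dvd // dvdp_XsubCl.
have rs_gt : sorted >%R rs by rewrite /rs rev_sorted; exact: sorted_roots.
have pick_nth (s : seq R) j : (forall x, x \in s -> x <= theta) -> nth 0 s j <= theta.
  by move=> hs; case: (ltnP j (size s)) => hj; [apply/hs/mem_nth | rewrite nth_default].
have flat_mem (s : seq R) x :
    x \in flatten [seq nseq (mup y (char_poly P)) y | y <- s] ->
    x \in s /\ (0 < mup x (char_poly P))%N.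
  move=> /flattenP[t /mapP[y ys ->]].
  by rewrite mem_nseq => /andP[my /eqP ->].
case: rs rs_gt rs_mup => [|x0 xs] //= + rs_mup.
rewrite path_sortedE; last by move=> a b c h1 h2; apply: lt_trans h2 h1.
move=> /andP[/allP x0max _].
have [x0le|x0gt] := lerP x0 theta.
  apply: pick_nth => x /(@flat_mem (x0 :: xs))[]; rewrite inE => /orP[/eqP -> //|/x0max xx0 _].
  exact: le_trans (ltW xx0) x0le.
have := rs_mup x0; rewrite mem_head mupE // lt0b => /(_ isT) x01; rewrite x01 /=.
apply: pick_nth => x /flat_mem[xin mx]; rewrite leNgt; apply/negP => hx.
move: mx; rewrite mupE // lt0b => /eqP x1.
by have /= := x0max x xin; rewrite x1 (eqP x01) ltxx.
Qed.
End SpectralGap.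

Section EnergyEndpoints.
Variables (R : realType) (T : finType) (mu : {set T} -> R) (k : nat) (f : {set T} -> R).

Lemma energy_top : energy mu k f k = \sum_(S : {set T} | #|S| == k) mu S * f S ^+ 2.
Proof.
rewrite /energy binn divr1; apply: eq_bigr => S Sk.
have full (h : {set T} -> R) : upw h k S = h S.
  move/eqP: Sk => Sk; rewrite /upw (big_pred1 S) // => S' /=.
  apply/andP/eqP => [[SS' /eqP S'k]|->]; last by rewrite subxx Sk.
  by apply/esym/eqP; rewrite eqEcard SS' S'k Sk leqnn.
rewrite !full; have [->|mn] := eqVneq (mu S) 0; first by rewrite !mul0r expr0n mul0r.
by field.
Qed.

Lemma energy0 :
  energy mu k f 0 = upw (fun S => mu S * f S) k set0 ^+ 2 / upw mu k set0.
Proof. by rewrite /energy bin0 divr1 (big_pred1 set0) // => U; rewrite /= cards_eq0. Qed.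
End EnergyEndpoints.

(** * The down-up walk as an operator on densities *)

Section ReversibleWalk.
Variables (R : realType) (T : finType) (mu : {set T} -> R) (k l : nat) (K : R).
Implicit Types (U S : {set T}).

Hypothesis mu_ge0 : forall S, 0 <= mu S.
Hypothesis mu_neq0 : exists S, #|S| = k /\ mu S <> 0.
Hypothesis l_le : (l <= k)%N.
Hypothesis K_ge1 : 1 <= K.
Hypothesis poincare : forall f,
  energy mu k f k - energy mu k f 0 <= K * (energy mu k f k - energy mu k f l).

Local Notation supp := (density_supp mu k).
Local Notation m := (upw mu k).
Local Notation st := (@enum_val _ (mem supp)).

Lemma supp_card (i : 'I_#|supp|) : #|st i| = k.
Proof. by have := enum_valP i; rewrite inE => /andP[/eqP]. Qed.

Lemma supp_gt0 (i : 'I_#|supp|) : 0 < mu (st i).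
Proof. by have := enum_valP i; rewrite inE => /andP[_ h]; rewrite lt0r h mu_ge0. Qed.

Lemma sum_supp (Q : pred {set T}) (g : {set T} -> R) :
  \sum_(S : {set T} | Q S && (#|S| == k)) mu S * g S
  = \sum_(i < #|supp| | Q (st i)) mu (st i) * g (st i).
Proof.
rewrite [RHS]big_mkcond -(big_enum_val (fun S => if Q S then mu S * g S else 0)) /=.
rewrite [LHS]big_mkcond [RHS]big_mkcond; apply: eq_bigr => S _; rewrite inE.
case: (Q S); case: (#|S| == k); rewrite ?if_same //=.
by case: eqP => // ->; rewrite mul0r.
Qed.

Lemma upw_supp U : m U = \sum_(i < #|supp| | U \subset st i) mu (st i).
Proof.
have := sum_supp (fun S => U \subset S) (fun=> 1).
by under eq_bigr do rewrite mulr1; under [in X in _ = X -> _]eq_bigr do rewrite mulr1.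
Qed.

Lemma upw_supp_gt0 U i : U \subset st i -> 0 < m U.
Proof.
move=> Ui; rewrite upw_supp (bigD1 i) //= ltr_pwDl ?supp_gt0 //.
by apply: sumr_ge0 => j _; exact: mu_ge0.
Qed.

(** After deflating by the stationary law [v], a left eigenvector [w] with eigenvalue [x] above the
    bound has total mass 0 and is an eigenvector of [P]. Written as w = mu f, it has energies E, 0
    and x E at levels [k], 0 and [l], so the Poincare inequality reads 1 <= K (1 - x). *)
Lemma lambda2_down_up_le : lambda2 (down_up_mx mu k l) <= 1 - K^-1.
Proof.
set P := down_up_mx mu k l.
have K0 : 0 < K by exact: lt_le_trans ltr01 K_ge1.
pose u : 'cV[R]_#|supp| := const_mx 1.
pose v : 'rV[R]_#|supp| := \row_j (mu (st j) / m set0).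
have [S0 [S0k S0n]] := mu_neq0.
have S0supp : S0 \in supp by rewrite inE S0k eqxx; apply/eqP.
have Z0 : 0 < m set0.
  have := @upw_supp_gt0 set0 (enum_rank_in S0supp S0); apply; exact: sub0set.
have C0 : 0 < 'C(k, l)%:R :> R by rewrite ltr0n bin_gt0.
have vu : (v *m u) 0 0 = 1.
  rewrite mxE; under eq_bigr => j _ do rewrite !mxE mulr1.
  rewrite -mulr_suml upw_supp; under [X in _ / X]eq_bigl => j do rewrite sub0set.
  by rewrite mulfV // -(eq_bigl _ _ (fun j => sub0set (st j))) -upw_supp gt_eqF.
have Pu : P *m u = u.
  apply/colP => i; rewrite !mxE; under eq_bigr => j _ do rewrite !mxE mulr1.
  rewrite exchange_big /=.
  have -> : \sum_U \sum_(j < #|supp|) down_prob R k l (st i) U * up_prob mu k U (st j)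
     = \sum_(U in [set A : {set T} | A \subset st i & #|A| == l]) 'C(k, l)%:R^-1.
    rewrite [RHS]big_mkcond; apply: eq_bigr => U _; rewrite inE /down_prob.
    case: ifP => [/andP[Ui _]|_]; last by rewrite big1 // => j _; rewrite mul0r.
    rewrite -mulr_sumr /up_prob.
    have -> : \sum_(j < #|supp|) (if (U \subset st j) && (#|st j| == k)
        then mu (st j) / \sum_(S' : {set T} | (U \subset S') && (#|S'| == k)) mu S' else 0)
      = \sum_(j < #|supp| | U \subset st j) mu (st j) / m U.
      by rewrite [RHS]big_mkcond; apply: eq_bigr => j _; rewrite supp_card eqxx andbT.
    by rewrite -mulr_suml -upw_supp mulfV ?mulr1 // gt_eqF // (upw_supp_gt0 Ui).
  by rewrite sumr_const cards_draws supp_card -[LHS]mulr_natr mulVf // gt_eqF.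
apply: (@lambda2_le _ _ P u v) => //.
  by rewrite subr_ge0 invf_le1.
move=> x hx; apply/negP => rx.
have x0 : 0 < x by apply: le_lt_trans hx; rewrite subr_ge0 invf_le1.
have : eigenvalue (P - u *m v) x by rewrite eigenvalue_root_char.
move=> /eigenvalueP[w wP w0].
have wu : w *m u = 0.
  have : (w *m (P - u *m v)) *m u = x *: (w *m u) by rewrite wP -scalemxAl.
  rewrite mulmxBr mulmxBl -mulmxA Pu -!mulmxA.
  have -> : v *m u = 1%:M by apply/matrixP => i j; rewrite !ord1 vu mxE eqxx.
  rewrite mulmx1 subrr => /esym/eqP; rewrite scaler_eq0 (gt_eqF x0) /= => /eqP //.
have wPx : w *m P = x *: w.
  by rewrite -wP mulmxBr mulmxA wu mul0mx subr0.
(* The density of [w] with respect to [mu]; the sum transports [w] from indices to sets and has at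
   most one term. *)
pose f S : R := (\sum_(i < #|supp| | st i == S) w 0 i) / mu S.
have fE i : mu (st i) * f (st i) = w 0 i.
  rewrite /f (big_pred1 i) => [|j]; last by rewrite (inj_eq enum_val_inj).
  by rewrite mulrC divfK // gt_eqF // supp_gt0.
pose F := upw (fun S => mu S * f S) k.
have FE U : F U = \sum_(i < #|supp| | U \subset st i) w 0 i.
  rewrite /F /upw (sum_supp (fun S => U \subset S)).
  by apply: eq_bigr => i _; rewrite fE.
pose E := \sum_(i < #|supp|) w 0 i ^+ 2 / mu (st i).
have E0 : 0 < E.
  have [i wi] : exists i, w 0 i != 0.
    apply/existsP; apply: contraNT w0; rewrite negb_exists => /forallP wz.
    by apply/eqP/rowP => i; rewrite mxE; apply/eqP; have := wz i; rewrite negbK.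
  rewrite /E (bigD1 i) //= ltr_pwDl //.
    by rewrite divr_gt0 ?supp_gt0 // exprn_even_gt0.
  by apply: sumr_ge0 => j _; rewrite divr_ge0 ?sqr_ge0 // ltW // supp_gt0.
have Ek : energy mu k f k = E.
  rewrite energy_top (sum_supp predT); apply: eq_bigr => i _.
  by rewrite -fE; field; rewrite gt_eqF ?supp_gt0.
have E00 : energy mu k f 0 = 0.
  rewrite energy0 -/F FE.
  have -> : \sum_(i < #|supp| | set0 \subset st i) w 0 i = (w *m u) 0 0.
    by rewrite mxE; apply: eq_big => [j|j _]; rewrite ?sub0set // mxE mulr1.
  by rewrite wu mxE expr0n /= mul0r.
have El : energy mu k f l = x * E.
  have -> : x * E = \sum_j (w *m P) 0 j * (w 0 j / mu (st j)).
    by rewrite wPx /E mulr_sumr; apply: eq_bigr => j _; rewrite mxE; ring.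
  have -> : \sum_j (w *m P) 0 j * (w 0 j / mu (st j))
    = \sum_U \sum_j \sum_i w 0 i * (down_prob R k l (st i) U * up_prob mu k U (st j))
         * (w 0 j / mu (st j)).
    rewrite exchange_big; apply: eq_bigr => j _ /=.
    rewrite exchange_big mxE mulr_suml; apply: eq_bigr => i _ /=.
    by rewrite [P _ _]mxE /down_up_prob mulr_sumr mulr_suml.
  rewrite /energy mulr_suml [LHS]big_mkcond; apply: eq_bigr => U _ /=.
  rewrite -/F; case: (boolP (#|U| == l)) => Ul; last first.
    rewrite big1 // => j _; rewrite big1 // => i _.
    by rewrite /down_prob (negPf Ul) andbF mul0r mulr0 mul0r.
  have -> : F U ^+ 2 / m U / 'C(k, l)%:R = F U * (F U / m U / 'C(k, l)%:R) by ring.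
  rewrite {1}FE [X in X * _]big_mkcond /= mulr_suml [RHS]exchange_big; apply: eq_bigr => i _ /=.
  rewrite /down_prob Ul andbT; case: (U \subset st i); last first.
    by rewrite mul0r big1 // => j _; rewrite mul0r mulr0 mul0r.
  rewrite FE [in LHS]big_mkcond /= !mulr_suml mulr_sumr; apply: eq_bigr => j _.
  rewrite /up_prob supp_card eqxx andbT; case: (boolP (U \subset st j)) => Uj; last first.
    by rewrite !mul0r !mulr0 mul0r.
  rewrite -/(upw mu k U); field; rewrite (gt_eqF C0) (gt_eqF (upw_supp_gt0 Uj)) (gt_eqF (supp_gt0 j)).
  by [].
have := poincare f; rewrite Ek E00 El subr0.
have -> : K * (E - x * E) = K * (1 - x) * E by ring.
rewrite -[leLHS]mul1r ler_pM2r // => hK.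
have : K^-1 <= 1 - x by rewrite -[K^-1]mulr1 ler_pdivrMl.
by move: hx; lra.
Qed.
End ReversibleWalk.

(** * Positive semidefinite matrices *)

Lemma horner_ge0_at0 (R : rcfType) (q : {poly R}) :
  (forall e, 0 < e -> 0 <= q.[e]) -> 0 <= q.[0].
Proof.
move=> hq; rewrite leNgt; apply/negP => q0.
have [d d0 hd] := @poly_cont _ 0 q (- q.[0]) ltac:(by rewrite oppr_gt0).
have /hd : `|d / 2 - 0| < d by rewrite subr0 gtr0_norm ?divr_gt0 //; lra.
have := hq (d / 2) ltac:(by rewrite divr_gt0).
by move=> h; rewrite ger0_norm; lra.
Qed.

Section PoincareLimit.
Variables (R : realType) (T : finType) (mp : {set T} -> {poly R}) (k l : nat) (K : R).
Implicit Types (U S : {set T}).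

Local Notation mu e := (fun S => (mp S).[e]).

Hypothesis k_le : (k <= #|T|)%N.
Hypothesis l_le : (l <= k)%N.
Hypothesis K_ge0 : 0 <= K.
Hypothesis mp_gt0 : forall e S, 0 < e -> 0 < (mp S).[e].
Hypothesis poincare_gt0 : forall e f, 0 < e ->
  energy (mu e) k f k - energy (mu e) k f 0
    <= K * (energy (mu e) k f k - energy (mu e) k f l).
Hypothesis upw0_gt0 : 0 < upw (mu 0) k set0.

Lemma horner_upw (h : {set T} -> {poly R}) U e :
  (upw h k U).[e] = upw (fun S => (h S).[e]) k U.
Proof. by rewrite /upw horner_sum. Qed.

(* Away from e = 0 the quotients F^2 / m are bounded below by 2 s F - s^2 m,
   which is polynomial in e and an equality at e = 0 for the right s. *)
Lemma poincare_at0 f :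
  energy (mu 0) k f k - energy (mu 0) k f 0
    <= K * (energy (mu 0) k f k - energy (mu 0) k f l).
Proof.
pose M := upw mp k; pose F := upw (fun S => mp S * (f S)%:P) k.
have ME U e : (M U).[e] = upw (mu e) k U by exact: horner_upw.
have FE U e : (F U).[e] = upw (fun S => (mp S).[e] * f S) k U.
  by rewrite horner_upw; apply: eq_bigr => S _; rewrite hornerM hornerC.
pose Ek := \sum_(S : {set T} | #|S| == k) mp S * (f S ^+ 2)%:P.
have EkE e : Ek.[e] = energy (mu e) k f k.
  rewrite energy_top horner_sum; apply: eq_bigr => S _.
  by rewrite hornerM hornerC.
pose s U := (F U).[0] / (M U).[0].
pose El := \sum_(U : {set T} | #|U| == l) ((2 * s U)%:P * F U - (s U ^+ 2)%:P * M U).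
have ElE e : El.[e] = \sum_(U : {set T} | #|U| == l)
    (2 * s U * (F U).[e] - s U ^+ 2 * (M U).[e]).
  by rewrite horner_sum; apply: eq_bigr => U _; rewrite hornerD hornerN !hornerM !hornerC.
have C0 : 0 < 'C(k, l)%:R :> R by rewrite ltr0n bin_gt0.
have El_le e : 0 < e -> El.[e] / 'C(k, l)%:R <= energy (mu e) k f l.
  move=> e0; rewrite /energy ler_pM2r ?invr_gt0 // ElE.
  apply: ler_sum => U /eqP Ul; rewrite -FE -ME.
  have m0 : 0 < (M U).[e].
    by rewrite ME; apply: upw_gt0 => //; [move=> S; exact: mp_gt0 | rewrite Ul].
  rewrite ler_pdivlMr // -subr_ge0.
  by rewrite [leRHS](_ : _ = ((F U).[e] - s U * (M U).[e]) ^+ 2) ?sqr_ge0 //; ring.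
have El0 : El.[0] / 'C(k, l)%:R = energy (mu 0) k f l.
  rewrite /energy; congr (_ / _); rewrite ElE; apply: eq_bigr => U _.
  (* A set [U] of zero mass at e = 0 has [s U = 0] and energy term 0, by the convention for division
     by 0. *)
  rewrite /s -FE -ME; have [->|mn] := eqVneq (M U).[0] 0; last by field.
  by rewrite invr0; ring.
(* The Poincare inequality multiplied by the total mass, with [El] in place of the lower energy: a
   polynomial in e, nonnegative for e > 0, hence also at 0. *)
pose q := (K - 1)%:P * Ek * M set0 + F set0 ^+ 2 - (K / 'C(k, l)%:R)%:P * El * M set0.
have qE e : q.[e] = (K - 1) * Ek.[e] * (M set0).[e] + (F set0).[e] ^+ 2
   - K * (El.[e] / 'C(k, l)%:R) * (M set0).[e].
  by rewrite /q !(hornerD, hornerN, hornerM, hornerC, horner_exp); ring.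
have q_ge0 e : 0 < e -> 0 <= q.[e].
  move=> e0; rewrite qE.
  have m0 : 0 < (M set0).[e].
    by rewrite ME; apply: upw_gt0 => //; [move=> S; exact: mp_gt0 | rewrite cards0].
  have := poincare_gt0 f e0; rewrite energy0 -EkE -FE -ME => hp.
  have hK : K * (El.[e] / 'C(k, l)%:R) <= K * energy (mu e) k f l.
    by rewrite ler_wpM2l // El_le.
  have : 0 <= ((K - 1) * Ek.[e] + (F set0).[e] ^+ 2 / (M set0).[e]
                - K * (El.[e] / 'C(k, l)%:R)) * (M set0).[e].
    by rewrite mulr_ge0 ?(ltW m0) //; lra.
  by rewrite mulrBl mulrDl divfK // gt_eqF.
have := horner_ge0_at0 q_ge0; rewrite qE El0 EkE.
rewrite energy0 -FE -ME; have m0 : 0 < (M set0).[0] by rewrite ME.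
have -> : (F set0).[0] ^+ 2 = (F set0).[0] ^+ 2 / (M set0).[0] * (M set0).[0].
  by rewrite divfK // gt_eqF.
rewrite -mulrDl -mulrBl pmulr_lge0 //.
by rewrite -[_ ^+ 2 / _ * _ / _]mulrA mulfV ?mulr1 ?gt_eqF //; lra.
Qed.
End PoincareLimit.

Section PrincipalMinors.
Variables (R : realType) (n : nat) (L : 'M[R]_n).
Hypothesis L_psd : psd (L + L^T).

Lemma psd_shift_pd e (x : 'I_n -> R) : 0 < e -> (exists i, x i != 0) ->
  0 < \sum_i x i * \sum_j (L + e%:M) i j * x j.
Proof.
move=> e0 [i0 xi0]; pose Q := \sum_i x i * \sum_j L i j * x j.
have Q0 : 0 <= Q.
  pose c : 'cV[R]_n := \col_i x i.
  have E (A : 'M[R]_n) : (c^T *m A *m c) 0 0 = \sum_i x i * \sum_j A i j * x j.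
    rewrite -mulmxA mxE; apply: eq_bigr => i _; rewrite !mxE; congr (_ * _).
    by apply: eq_bigr => j _; rewrite !mxE.
  have := L_psd c; rewrite mulmxDr mulmxDl mxE.
  have -> : (c^T *m L^T *m c) 0 0 = (c^T *m L *m c) 0 0.
    by rewrite -[in RHS](trmxK c) -[in LHS](trmxK c) -mulmxA -!trmx_mul mxE trmxK.
  by rewrite E -/Q; lra.
have -> : \sum_i x i * (\sum_j (L + e%:M) i j * x j) = Q + e * \sum_i x i ^+ 2.
  rewrite mulr_sumr -big_split; apply: eq_bigr => i _ /=.
  have -> : \sum_j (L + e%:M) i j * x j = \sum_j L i j * x j + e * x i.
    under eq_bigr => j _ do rewrite !mxE mulrDl.
    rewrite big_split /= [X in _ + X](bigD1 i) //= eqxx mulr1n [X in _ + (_ + X)]big1 ?addr0 // => j ji.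
    by rewrite eq_sym (negPf ji) mulr0n mul0r.
  by ring.
apply: ltr_wpDl => //; rewrite mulr_gt0 // (bigD1 i0) //= ltr_pwDl //.
  by rewrite exprn_even_gt0.
by apply: sumr_ge0 => j _; exact: sqr_ge0.
Qed.

Definition minor_poly (S : {set 'I_n}) : {poly R} :=
  \det (map_mx polyC (principal_submx L S) + 'X%:M).

Lemma horner_minor_poly S e : (minor_poly S).[e] = principal_minor (L + e%:M) S.
Proof.
rewrite -[LHS]/(horner_eval e (minor_poly S)) -det_map_mx; congr (\det _).
apply/matrixP => i j; rewrite !mxE /= /horner_eval hornerD hornerC hornerMn hornerX.
by rewrite (inj_eq enum_val_inj).
Qed.

Lemma minor_poly_gt0 e S : 0 < e -> 0 < (minor_poly S).[e].
Proof.
move=> e0; rewrite horner_minor_poly; apply: pd_principal_minor_gt0.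
by move=> x; exact: psd_shift_pd.
Qed.

Lemma psd_principal_minor_ge0 S : 0 <= principal_minor L S.
Proof.
have <- : (minor_poly S).[0] = principal_minor L S.
  by rewrite horner_minor_poly !raddf0 ?addr0.
by apply: horner_ge0_at0 => e e0; rewrite ltW // minor_poly_gt0.
Qed.

Lemma principal_minor_poincare k f : (1 < k <= n)%N ->
  (exists S : {set 'I_n}, #|S| = k /\ principal_minor L S <> 0) ->
  energy (principal_minor L) k f k - energy (principal_minor L) k f 0
   <= (1 + k%:R * (63%:R ^+ 3 * (k + 3)%:R ^+ 8)) *
      (energy (principal_minor L) k f k - energy (principal_minor L) k f (k - 2)%N).
Proof.
move=> /andP[k2 kn] [S [Sk Sn]]; have kT : (k <= #|'I_n|)%N by rewrite card_ord.
have mu0 : principal_minor L = (fun S => (minor_poly S).[0]).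
  apply: funext => V; rewrite horner_minor_poly; congr principal_minor.
  by apply/matrixP => i j; rewrite !mxE mul0rn addr0.
rewrite mu0; apply: poincare_at0 => //.
- by lia.
- by rewrite addr_ge0 // mulr_ge0 // mulr_ge0 // exprn_ge0.
- by move=> e V; exact: minor_poly_gt0.
- move=> e g e0.
  have pd := fun x => @psd_shift_pd e x e0.
  have -> : (fun S => (minor_poly S).[e]) = principal_minor (L + e%:M).
    by apply: funext => V; rewrite horner_minor_poly.
  have pos := pd_principal_minor_gt0 pd.
  have nz := pd_gen_poly_neq0 pd.
  apply: energy_gap => // V x Vk; first by apply: link_cheeger => //; lia.
  exact: link_quadratic_form_le.
- rewrite -mu0 /upw (bigD1 S) /=; last by rewrite sub0set Sk eqxx.
  apply: ltr_pwDl; first by rewrite lt0r psd_principal_minor_ge0 andbT; apply/eqP.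
  by apply: sumr_ge0 => V _; exact: psd_principal_minor_ge0.
Qed.
End PrincipalMinors.

Theorem theorem1p11 (R : realType) :
  exists p : {poly R},
    forall (n k : nat) (L : 'M[R]_n),
      psd (L + L^T) ->
      (2 <= k <= n)%N ->
      (exists S : {set 'I_n}, #|S| = k /\ principal_minor L S <> 0) ->
      (relaxation_time (down_up_mx (principal_minor L) k (k - 2))
         <= (p.[k%:R])%:E)%E.
Proof.
(* The constant of [energy_gap] as a polynomial in k, of degree 9. *)
exists (1 + 'X * ((63%:R ^+ 3)%:P * ('X + 3%:R%:P) ^+ 8)) => n k L psdL k2 muk.
set p := (_ + _); pose K : R := 1 + k%:R * (63%:R ^+ 3 * (k + 3)%:R ^+ 8).
have -> : p.[k%:R] = K by rewrite /p /K natrD !hornerE.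
have K1 : 1 <= K by rewrite lerDl mulr_ge0 // mulr_ge0 // exprn_ge0.
have K0 : 0 < K := lt_le_trans ltr01 K1.
have hl : lambda2 (down_up_mx (principal_minor L) k (k - 2)) <= 1 - K^-1.
  apply: lambda2_down_up_le => //.
  - by move=> S; exact: psd_principal_minor_ge0.
  - by lia.
  - by move=> f; exact: principal_minor_poincare.
have Ki : 0 < K^-1 by rewrite invr_gt0.
rewrite /relaxation_time; have -> : lambda2 (down_up_mx (principal_minor L) k (k - 2)) < 1.
  by lra.
by rewrite lee_fin -[leRHS]invrK lef_pV2 ?posrE //; lra.
Qed.
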